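(* Let $W$ be an affine Coxeter group of type $\tilde A$, $\tilde B$, $\tilde C$ or $\tilde D$, and let $w\in W$ be a CFC element. Then $w$ is logarithmic if and only if a (equivalently, any) reduced expression $\mathbf{w}$ of $w$ has full support (i.e. all generators of $W$ occur in $\mathbf{w}$). In particular, there is a finite number of CFC elements in $W$ which are not logarithmic.
   Context: The types are the classical affine families: $\tilde A_{n-1}$ ($n\ge3$): generators $s_0,\dots,s_{n-1}$, diagram an $n$-cycle with all $m=3$; $\tilde C_n$ ($n\ge2$): path $t-s_1-\cdots-s_{n-1}-u$ with $m_{ts_1}=m_{s_{n-1}u}=4$ and other edges $m=3$; $\tilde B_{n+1}$ ($n\ge2$): generators $t_1,t_2,s_1,\dots,s_{n-1},u$, edges $t_1-s_1$, $t_2-s_1$, $s_i-s_{i+1}$ with $m=3$ and $s_{n-1}-u$ with $m=4$; $\tilde D_{n+2}$ ($n\ge2$): generators $t_1,t_2,s_1,\dots,s_{n-1},u_1,u_2$, edges $t_1-s_1$, $t_2-s_1$, $s_i-s_{i+1}$, $s_{n-1}-u_1$, $s_{n-1}-u_2$, all $m=3$. An element of a Coxeter group is fully commutative (FC) if any two of its reduced expressions are related by a sequence of transpositions of adjacent commuting generators. A cyclic shift of a word $s_{i_1}\cdots s_{i_k}$ is any word $s_{i_j}\cdots s_{i_k}s_{i_1}\cdots s_{i_{j-1}}$. An element is cyclically fully commutative (CFC) if every cyclic shift of every one of its reduced expressions is a reduced expression of an FC element. With $\ell$ the Coxeter length, $w\in W$ is logarithmic if $\ell(w^k)=k\,\ell(w)$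 for all positive integers $k$.
   Formalization: The equivalence ''w is logarithmic if and only if a reduced expression has full support'' is stated for CFC w other than the identity: the identity is CFC and logarithmic, but its only reduced expression is the empty word, which does not have full support. *)

(* Defs.v *)
From HB Require Import structures.
From mathcomp Require Import all_boot.
From mathcomp Require Import boolp classical_sets cardinality.

Set Implicit Arguments.
Unset Strict Implicit.
Unset Printing Implicit Defensive.

(* The value 0 of [cox_m] stands for infinity: the relation (s t)^0 = 1 is
   void. *)
Record coxeterMatrix := CoxeterMatrix {
  cox_gen : finType;
  cox_m : cox_gen -> cox_gen -> nat;
  cox_m_eq1 : forall s t, (cox_m s t == 1%N) = (s == t);
  cox_m_sym : forall s t, cox_m s t = cox_m t s }.

Section CoxeterGroup.
Local Open Scope group_scope.
Local Open Scope quotient_scope.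
Variable M : coxeterMatrix.

Local Notation cox_word := (seq (cox_gen M)).

(* The congruence on words generated by (s t)^(m s t) = 1. As m s s = 1, it
   makes every generator its own inverse, so the monoid presented here is the
   Coxeter group. *)
Inductive cox_eq : cox_word -> cox_word -> Prop :=
| cox_eq_refl u : cox_eq u u
| cox_eq_sym u v : cox_eq u v -> cox_eq v u
| cox_eq_trans v u x : cox_eq u v -> cox_eq v x -> cox_eq u x
| cox_eq_rel u v s t :
    cox_eq (u ++ flatten (nseq (cox_m s t) [:: s; t]) ++ v) (u ++ v).

Definition cox_eqb : rel cox_word := fun u v => `[< cox_eq u v >].

Lemma cox_eqb_refl : reflexive cox_eqb.
Proof. by move=> u; apply/asboolP; exact: cox_eq_refl. Qed.

Lemma cox_eqb_sym : symmetric cox_eqb.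
Proof. by move=> u v; apply: asbool_equiv_eq; split; exact: cox_eq_sym. Qed.

Lemma cox_eqb_trans : transitive cox_eqb.
Proof.
by move=> v u x /asboolP uv /asboolP vx; apply/asboolP; exact: cox_eq_trans vx.
Qed.

Canonical cox_equiv :=
  EquivRel cox_eqb cox_eqb_refl cox_eqb_sym cox_eqb_trans.

Definition coxeterGroup := {eq_quot cox_equiv}.
HB.instance Definition _ := Choice.on coxeterGroup.
HB.instance Definition _ := EqQuotient.on coxeterGroup.

Lemma cox_piP (u v : cox_word) :
  \pi_coxeterGroup u = \pi_coxeterGroup v <-> cox_eq u v.
Proof.
split=> [/eqmodP /asboolP //|uv]; apply/eqmodP/asboolP; exact: uv.
Qed.

Lemma cox_eq_cat (u u' v v' : cox_word) :
  cox_eq u u' -> cox_eq v v' -> cox_eq (u ++ v) (u' ++ v').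
Proof.
move=> uu' vv'; apply: (@cox_eq_trans (u' ++ v)).
  elim: uu' => {u u'} [u|u u' _|u x y _ IH1 _ IH2|u u' s t].
  - exact: cox_eq_refl.
  - exact: cox_eq_sym.
  - exact: cox_eq_trans IH1 IH2.
  - by rewrite -!catA; exact: cox_eq_rel.
elim: vv' => {v v'} [v|v v' _|v x y _ IH1 _ IH2|v v' s t].
- exact: cox_eq_refl.
- exact: cox_eq_sym.
- exact: cox_eq_trans IH1 IH2.
- by rewrite !catA -(catA (u' ++ v)); exact: cox_eq_rel.
Qed.

Lemma cox_eq_rev (u v : cox_word) : cox_eq u v -> cox_eq (rev u) (rev v).
Proof.
elim=> {u v} [u|u v _|u x y _ IH1 _ IH2|u v s t].
- exact: cox_eq_refl.
- exact: cox_eq_sym.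
- exact: cox_eq_trans IH1 IH2.
- have -> : rev (u ++ flatten (nseq (cox_m s t) [:: s; t]) ++ v) =
            rev v ++ flatten (nseq (cox_m t s) [:: t; s]) ++ rev u.
    rewrite !rev_cat -catA rev_flatten map_nseq rev_nseq cox_m_sym.
    by [].
  by rewrite rev_cat; exact: cox_eq_rel.
Qed.

Lemma cox_eq_revl (u : cox_word) : cox_eq (rev u ++ u) [::].
Proof.
elim: u => [|s u IH]; first exact: cox_eq_refl.
rewrite rev_cons -cats1 -catA /=.
apply: cox_eq_trans IH.
have := cox_eq_rel (rev u) u s s.
by have /eqP -> : cox_m s s == 1%N by rewrite cox_m_eq1.
Qed.

Definition cox_one : coxeterGroup := \pi_coxeterGroup [::].
Definition cox_mul (x y : coxeterGroup) : coxeterGroup :=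
  \pi_coxeterGroup (repr x ++ repr y).
Definition cox_inv (x : coxeterGroup) : coxeterGroup := \pi_coxeterGroup (rev (repr x)).

Lemma cox_repr (u : cox_word) : cox_eq (repr (\pi_coxeterGroup u)) u.
Proof. by apply/cox_piP; rewrite reprK. Qed.

Lemma cox_pi_cat (u v : cox_word) :
  \pi_coxeterGroup (u ++ v) = cox_mul (\pi_coxeterGroup u) (\pi_coxeterGroup v).
Proof. by apply/cox_piP/cox_eq_sym/cox_eq_cat; exact: cox_repr. Qed.

Lemma cox_pi_surj (x : coxeterGroup) :
  exists u : cox_word, x = \pi_coxeterGroup u.
Proof. by exists (repr x); rewrite reprK. Qed.

Lemma cox_mulA : associative cox_mul.
Proof.
move=> x y z; have [u ->] := cox_pi_surj x; have [v ->] := cox_pi_surj y.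
have [t ->] := cox_pi_surj z; by rewrite -!cox_pi_cat catA.
Qed.

Lemma cox_mul1 : left_id cox_one cox_mul.
Proof. by move=> x; have [u ->] := cox_pi_surj x; rewrite -cox_pi_cat. Qed.

Lemma cox_mulr1 : right_id cox_one cox_mul.
Proof. by move=> x; have [u ->] := cox_pi_surj x; rewrite -cox_pi_cat cats0. Qed.

Lemma cox_pi_rev (u : cox_word) :
  \pi_coxeterGroup (rev u) = cox_inv (\pi_coxeterGroup u).
Proof. by apply/cox_piP/cox_eq_sym/cox_eq_rev; exact: cox_repr. Qed.

Lemma cox_mulV : left_inverse cox_one cox_inv cox_mul.
Proof.
move=> x; have [u ->] := cox_pi_surj x; rewrite -cox_pi_rev -cox_pi_cat.
by apply/cox_piP; exact: cox_eq_revl.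
Qed.

Lemma cox_mulrV : right_inverse cox_one cox_inv cox_mul.
Proof.
move=> x; have [u ->] := cox_pi_surj x; rewrite -cox_pi_rev -cox_pi_cat.
by apply/cox_piP; rewrite -{1}(revK u); exact: cox_eq_revl.
Qed.

HB.instance Definition _ := isGroup.Build coxeterGroup
  cox_mulA cox_mul1 cox_mulr1 cox_mulV cox_mulrV.

Definition gen_elt (s : cox_gen M) : coxeterGroup := \pi_coxeterGroup [:: s].

Definition word_elt (u : cox_word) : coxeterGroup := \prod_(s <- u) gen_elt s.

Lemma word_eltE (u : cox_word) : word_elt u = \pi_coxeterGroup u.
Proof.
elim: u => [|s u IH]; first by rewrite /word_elt big_nil.
by rewrite /word_elt big_cons -/(word_elt u) IH -cat1s cox_pi_cat.
Qed.

Lemma cox_length_subproof (w : coxeterGroup) :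
  exists n, `[< exists2 u, word_elt u = w & size u = n >].
Proof.
exists (size (repr w)); apply/asboolP; exists (repr w) => //.
by rewrite word_eltE reprK.
Qed.

Definition cox_length (w : coxeterGroup) : nat :=
  ex_minn (cox_length_subproof w).

Definition reduced_expr (w : coxeterGroup) (u : cox_word) : Prop :=
  word_elt u = w /\ size u = cox_length w.

Inductive comm_equiv : cox_word -> cox_word -> Prop :=
| comm_equiv_refl u : comm_equiv u u
| comm_equiv_step u v x s t : commute (gen_elt s) (gen_elt t) ->
    comm_equiv (u ++ [:: t; s] ++ v) x -> comm_equiv (u ++ [:: s; t] ++ v) x.

Definition fully_commutative (w : coxeterGroup) : Prop :=
  forall u v, reduced_expr w u -> reduced_expr w v -> comm_equiv u v.

(* The cyclic shifts of [u] are the [rot j u]; [rot j u = u] for j beyond the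
   size of [u]. *)
Definition cyclically_fully_commutative (w : coxeterGroup) : Prop :=
  forall u j, reduced_expr w u ->
    reduced_expr (word_elt (rot j u)) (rot j u) /\
    fully_commutative (word_elt (rot j u)).

Definition logarithmic (w : coxeterGroup) : Prop :=
  forall k, (0 < k)%N -> cox_length (w ^+ k) = (k * cox_length w)%N.

Definition full_support (u : cox_word) : Prop := forall s, s \in u.

End CoxeterGroup.

(* Type ~A_(n-1): the n-cycle on s_0, ..., s_(n-1). *)
Definition cycle_m n (i j : 'I_n) : nat :=
  if i == j then 1
  else if (i.+1 %% n == j) || (j.+1 %% n == i) then 3 else 2.

Lemma cycle_m_eq1 n (i j : 'I_n) : (cycle_m i j == 1%N) = (i == j).
Proof. by rewrite /cycle_m; case: (i == j) => //; case: ifP. Qed.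

Lemma cycle_m_sym n (i j : 'I_n) : cycle_m i j = cycle_m j i.
Proof. by rewrite /cycle_m eq_sym orbC. Qed.

Definition typeA n : coxeterMatrix :=
  CoxeterMatrix (@cycle_m_eq1 n) (@cycle_m_sym n).

(* A path s_1 - ... - s_(n-1), where i : 'I_n.-1 stands for s_(i+1), together
   with left ends in L, each joined to s_1 with label mL, and right ends in R,
   each joined to s_(n-1) with label mR. *)
Definition path_m n (L R : finType) (mL mR : nat)
    (x y : L + 'I_n.-1 + R) : nat :=
  if x == y then 1 else
  match x, y with
  | inl (inr i), inl (inr j) =>
      if (i.+1 == j :> nat) || (j.+1 == i :> nat) then 3 else 2
  | inl (inl _), inl (inr i) | inl (inr i), inl (inl _) =>
      if i == 0 :> nat then mL else 2
  | inl (inr i), inr _ | inr _, inl (inr i) =>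
      if i.+1 == n.-1 :> nat then mR else 2
  | _, _ => 2
  end.

Lemma path_m_eq1 n (L R : finType) mL mR (x y : L + 'I_n.-1 + R) :
  (1 < mL)%N -> (1 < mR)%N -> (path_m mL mR x y == 1%N) = (x == y).
Proof.
rewrite /path_m; case: (x == y) => // mL_gt1 mR_gt1.
have nL : (mL == 1%N) = false by case: mL mL_gt1 => [|[]].
have nR : (mR == 1%N) = false by case: mR mR_gt1 => [|[]].
by case: x => [[?|?]|?]; case: y => [[?|?]|?] //; case: ifP.
Qed.

Lemma path_m_sym n (L R : finType) mL mR (x y : L + 'I_n.-1 + R) :
  path_m mL mR x y = path_m mL mR y x.
Proof.
rewrite /path_m eq_sym; case: (y == x) => //.
by case: x => [[?|?]|?]; case: y => [[?|?]|?] //=; rewrite orbC.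
Qed.

Definition path_matrix n (L R : finType) mL mR
    (mL_gt1 : (1 < mL)%N) (mR_gt1 : (1 < mR)%N) : coxeterMatrix :=
  @CoxeterMatrix (L + 'I_n.-1 + R)%type (@path_m n L R mL mR)
    (fun x y => path_m_eq1 x y mL_gt1 mR_gt1) (@path_m_sym n L R mL mR).

(* Type ~B_(n+1): left ends t_1, t_2, right end u. *)
Definition typeB n : coxeterMatrix :=
  @path_matrix n bool unit 3 4 isT isT.

(* Type ~C_n: left end t, right end u. *)
Definition typeC n : coxeterMatrix :=
  @path_matrix n unit unit 4 4 isT isT.

(* Type ~D_(n+2): left ends t_1, t_2, right ends u_1, u_2. *)
Definition typeD n : coxeterMatrix :=
  @path_matrix n bool bool 3 3 isT isT.

Inductive classical_affine : coxeterMatrix -> Prop :=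
| AffineA n : (3 <= n)%N -> classical_affine (typeA n)
| AffineB n : (2 <= n)%N -> classical_affine (typeB n)
| AffineC n : (2 <= n)%N -> classical_affine (typeC n)
| AffineD n : (2 <= n)%N -> classical_affine (typeD n).

(* Main.v *)
Require Import Defs.
From mathcomp Require Import all_boot all_order all_algebra.
From mathcomp Require Import boolp classical_sets cardinality.
From mathcomp Require Import zify ring lra.

Set Implicit Arguments.
Unset Strict Implicit.
Unset Printing Implicit Defensive.

(** Let [u] be a reduced word of a cyclically fully commutative element [w].

    If [u] misses a generator [o], then every power of [w] lies in a proper
    parabolic subgroup of an affine group, and such a subgroup is finite
    ([parabolic_bounded]).  Hence the lengths of the powers are bounded and [w]
    is logarithmic only if it is trivial; moreover only finitely many elements
    have a reduced word that misses a generator, which gives the finiteness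
    assertion.

    If [u] has full support, the claim is that all powers of [u] are reduced.  A
    word is reduced as soon as no word in its commutation class contains a
    square [s s] or a braid of full length ([clean_matsumoto]).  All rotations
    of [u] have this property ([clean_of_unique]).  A square or a braid in the
    class of a power of [u] comes from a convex chain of letters there.  If the
    chain fits in a rotation of [u] there is a contradiction; otherwise it winds
    around, and then full support shows that it is [s t s] with [s] a leaf of
    the diagram on a simple edge to [t], both occurring once in [u]
    ([clean_power]).  This happens only in types B and D.  There, following the
    gaps between equal letters along the path of the diagram to its other end
    and back shows that every generator occurs once ([path_pendant_uniq]): [w]
    is a Coxeter element.  Powers of Coxeter elements of an affine group are
    reduced for another reason: there is a linear functional that is invariant
    under [w] and positive on all the roots that the word meets, so that no two
    of these roots can cancel ([coxeter_power_reduced]).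

    The tool behind all three parts is the geometric representation, over the
    integers and in dual form, as a game on integer labellings of the diagram:
    firing [s] subtracts from each label the multiple of the label of [s] that
    the Cartan matrix prescribes.  The label of [s] after playing [u] is, as a
    functional of the initial labelling, the root that [u] makes of the simple
    root of [s]. *)

(** * Reduced words and dihedral subgroups *)

Section Words.
Variable M : coxeterMatrix.
Local Notation S := (cox_gen M).
Local Notation "u =W v" := (@cox_eq M u v) (at level 70).
Implicit Types (u v x y : seq S) (s t : S).

Lemma cox_eq_catl x u v : u =W v -> x ++ u =W x ++ v.
Proof. by move=> uv; apply: cox_eq_cat => //; exact: cox_eq_refl. Qed.

Lemma cox_eq_catr x u v : u =W v -> u ++ x =W v ++ x.
Proof. by move=> uv; apply: cox_eq_cat => //; exact: cox_eq_refl. Qed.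

Lemma cox_eq_rcons s u v : u =W v -> rcons u s =W rcons v s.
Proof. by rewrite -!cats1; exact: cox_eq_catr. Qed.

Lemma cox_eq_square u s v : u ++ [:: s; s] ++ v =W u ++ v.
Proof.
have := cox_eq_rel u v s s.
by have /eqP -> : cox_m s s == 1%N by rewrite cox_m_eq1.
Qed.

Lemma cox_eq_rcons2 u s : rcons (rcons u s) s =W u.
Proof.
by have := cox_eq_square u s [::]; rewrite !cats0 -!cats1 -catA.
Qed.

Lemma cox_eq_rconsl u v s : rcons u s =W v -> u =W rcons v s.
Proof.
move=> /(cox_eq_rcons s) E; apply: cox_eq_trans E.
exact/cox_eq_sym/cox_eq_rcons2.
Qed.

Lemma cox_eq_rconsI u v s : rcons u s =W rcons v s -> u =W v.
Proof. by move/cox_eq_rconsl => E; apply: cox_eq_trans E _; exact: cox_eq_rcons2. Qed.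

Lemma cox_eq_revr u : u ++ rev u =W [::].
Proof. by rewrite -{1}(revK u); exact: cox_eq_revl. Qed.

Lemma cox_eq_transpose u v : u ++ v =W [::] -> u =W rev v.
Proof.
move=> /(cox_eq_catr (rev v)) /= uv; apply: cox_eq_trans uv.
rewrite -catA -{1}[u]cats0; apply: cox_eq_catl.
exact/cox_eq_sym/cox_eq_revr.
Qed.

Lemma cox_eq_parity u v : u =W v -> odd (size u) = odd (size v).
Proof.
elim=> // [x y z _ -> _ -> //|x y s t].
rewrite !size_cat !oddD size_flatten /shape map_nseq sumn_nseq /=.
by rewrite oddM.
Qed.

(** Unlike [reduced_expr], this does not name the element. *)
Definition reduced u := forall v, u =W v -> size u <= size v.

Lemma reduced_ex u : exists2 v, u =W v & reduced v.
Proof.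
have [n] := ubnP (size u); elim: n u => // n IH u /ltnSE le_un.
have [|/existsNP [v /not_implyP [uv /negP]]] := pselect (reduced u).
  by exists u => //; exact: cox_eq_refl.
rewrite -ltnNge => lt_vu; have [x vx rx] := IH v (leq_trans lt_vu le_un).
by exists x => //; exact: cox_eq_trans vx.
Qed.

Lemma reduced_size u v : reduced u -> reduced v -> u =W v -> size u = size v.
Proof.
by move=> ru rv uv; apply/eqP; rewrite eqn_leq ru //= rv //; exact: cox_eq_sym.
Qed.

Lemma reduced_eq u v : reduced u -> u =W v -> size v <= size u -> reduced v.
Proof.
by move=> ru uv le_vu x vx; apply: leq_trans le_vu (ru _ (cox_eq_trans uv vx)).
Qed.

Lemma reduced_catl u v : reduced (u ++ v) -> reduced u.
Proof.
by move=> r x /(cox_eq_catr v) /r; rewrite !size_cat leq_add2r.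
Qed.

Lemma reduced_catr u v : reduced (u ++ v) -> reduced v.
Proof.
by move=> r x /(cox_eq_catl u) /r; rewrite !size_cat leq_add2l.
Qed.

Lemma reduced_rcons u s : reduced (rcons u s) -> reduced u.
Proof. by rewrite -cats1; exact: reduced_catl. Qed.

Lemma not_reduced_square u s v : ~ reduced (u ++ [:: s; s] ++ v).
Proof.
by move=> /(_ _ (cox_eq_square u s v)); rewrite !size_cat /=; lia.
Qed.

(* Parity excludes that appending a letter preserves the length. *)
Lemma not_reduced_rcons u s : reduced u -> ~ reduced (rcons u s) ->
  exists v, [/\ u =W rcons v s, size u = (size v).+1 & reduced (rcons v s)].
Proof.
move=> ru nr; have [v uv rv] := reduced_ex (rcons u s).
have uvs := cox_eq_rconsl uv; exists v.
have lt_vu : size v < (size u).+1.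
  rewrite ltnNge; apply/negP=> le_uv; apply: nr.
  by apply: reduced_eq rv (cox_eq_sym uv) _; rewrite size_rcons.
have := cox_eq_parity uv; rewrite size_rcons => par.
have := ru _ uvs; rewrite size_rcons => le_uv.
have sz : size u = (size v).+1 by lia.
by split=> //; apply: reduced_eq ru uvs _; rewrite size_rcons sz.
Qed.

Lemma not_reduced_rcons2 u s : ~ reduced (rcons (rcons u s) s).
Proof.
by rewrite -!cats1 -catA; have := @not_reduced_square u s [::]; rewrite cats0.
Qed.

Lemma word_eltP u v : word_elt u = word_elt v <-> u =W v.
Proof. by rewrite !word_eltE; exact: cox_piP. Qed.

Lemma cox_length_le (w : coxeterGroup M) u : word_elt u = w -> cox_length w <= size u.
Proof.
move=> uw; rewrite /cox_length; case: ex_minnP => n _; apply.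
by apply/asboolP; exists u.
Qed.

Lemma reduced_expr_ex (w : coxeterGroup M) : exists u, reduced_expr w u.
Proof.
rewrite /reduced_expr /cox_length; case: ex_minnP => n /asboolP [u uw un] _.
by exists u.
Qed.

Lemma reduced_exprE (w : coxeterGroup M) u :
  reduced_expr w u <-> word_elt u = w /\ reduced u.
Proof.
split=> -[uw ru]; split=> //.
  by move=> v /word_eltP uv; rewrite ru; apply: cox_length_le; rewrite -uv.
have [v [vw sz]] := reduced_expr_ex w.
apply/eqP; rewrite eqn_leq cox_length_le // andbT -sz.
by apply: ru; apply/word_eltP; rewrite uw.
Qed.

Lemma reduced_length u : reduced u -> cox_length (word_elt u) = size u.
Proof. by move=> ru; have [|_ <-] := (reduced_exprE (word_elt u) u).2. Qed.

Lemma word_elt_cat u v : word_elt (u ++ v) = (word_elt u * word_elt v)%g.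
Proof. by rewrite /word_elt big_cat. Qed.

(** Indexed by the last letter, because words grow on the right below. *)
Fixpoint alt s t k := if k is k'.+1 then rcons (alt t s k') s else [::].

Lemma size_alt s t k : size (alt s t k) = k.
Proof. by elim: k s t => //= k IH s t; rewrite size_rcons IH. Qed.

Lemma alt_suffix s t j k : j <= k -> exists x, alt s t k = x ++ alt s t j.
Proof.
elim: k j s t => [|k IH] [|j] s t //=; first by exists [::].
  by exists (rcons (alt t s k) s); rewrite cats0.
by move=> /(IH j t s) [x ->]; exists x; rewrite rcons_cat.
Qed.

(** The two reduced words of the longest element of a dihedral subgroup. *)
Lemma cox_eq_braid s t : cox_m s t \in [:: 2; 3; 4] ->
  alt s t (cox_m s t) =W alt t s (cox_m s t).
Proof.
have := cox_eq_rel [::] [::] t s; rewrite cox_m_sym cats0 /=.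
rewrite !inE => + /or3P [] /eqP m; rewrite m /= => rel.
- exact: (@cox_eq_transpose [:: t; s] [:: t; s]).
- exact: (cox_eq_sym (@cox_eq_transpose [:: t; s; t] [:: s; t; s] _)).
- exact: (@cox_eq_transpose [:: t; s; t; s] [:: t; s; t; s]).
Qed.

Lemma not_reduced_alt s t k : cox_m s t \in [:: 2; 3; 4] ->
  cox_m s t < k -> ~ reduced (alt s t k).
Proof.
move=> m /(alt_suffix s t) [x ->] /reduced_catr /=.
have := cox_eq_braid m; case: (cox_m s t) m => // k' _ /= /cox_eq_sym E.
move=> /(_ _ (cox_eq_trans (cox_eq_rcons s E) (cox_eq_rcons2 _ s))).
by rewrite !size_rcons !size_alt; lia.
Qed.

Lemma reduced_alternates s t d : s != t -> all (pred2 s t) d -> reduced d ->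
  d = alt s t (size d) \/ d = alt t s (size d).
Proof.
move=> st; elim/last_ind: d => [|d x IH]; first by left.
rewrite all_rcons size_rcons => /andP [/orP x_st d_st] rd.
have no_square a b k : reduced (rcons (alt a b k.+1) a) -> False.
  by move=> /= /not_reduced_rcons2.
have := IH d_st (reduced_rcons rd); move: rd => + [] ed; rewrite ed !size_alt;
  move: {ed}(size d) => k;
  case: x_st => /eqP ->; case: k => [|k]; auto => /no_square [].
Qed.

(** Every element factors, with lengths adding, as a minimal representative of
    its coset modulo the dihedral subgroup of [s] and [t] and an element of this
    subgroup: strip right descents in [s] and [t] as long as there are any. *)
Lemma dihedral_decomposition s t u : reduced u ->
  exists v d, [/\ u =W v ++ d, size u = size v + size d, all (pred2 s t) d,
                  reduced (rcons v s) & reduced (rcons v t)].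
Proof.
have [n] := ubnP (size u); elim: n u => // n IH u /ltnSE le_un ru.
have step r : r \in [:: s; t] -> ~ reduced (rcons u r) ->
    exists v d, [/\ u =W v ++ d, size u = size v + size d, all (pred2 s t) d,
                    reduced (rcons v s) & reduced (rcons v t)].
  move=> r_st nr; have [w [uw sz rw]] := not_reduced_rcons ru nr.
  have lt_wn : size w < n by lia.
  have [v [d [wv szw d_st rs rt]]] := IH w lt_wn (reduced_rcons rw).
  exists v, (rcons d r); split=> //.
  - by rewrite -rcons_cat; apply: cox_eq_trans uw _; exact: cox_eq_rcons.
  - by rewrite size_rcons; lia.
  - by rewrite all_rcons d_st andbT /=; rewrite !inE in r_st.
have [rs|/step] := pselect (reduced (rcons u s)); last by apply; rewrite inE eqxx.
have [rt|/step] := pselect (reduced (rcons u t)); last by apply; rewrite !inE eqxx orbT.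
by exists u, [::]; rewrite cats0 addn0; split=> //; exact: cox_eq_refl.
Qed.
End Words.

(** * The geometric representation as a game on labellings *)

Section NumbersGame.
Import Order.TTheory GRing.Theory Num.Theory.
Local Open Scope ring_scope.
Variable M : coxeterMatrix.
Local Notation S := (cox_gen M).
Local Notation "u =W v" := (@cox_eq M u v) (at level 70).

(** The product of the two off-diagonal entries determines the label of the
    edge; non-symmetric entries are what keeps double edges integral. *)
Definition cartan (A : S -> S -> int) : Prop :=
  (forall s, A s s = 2) /\
  forall s t, s != t ->
    [\/ [/\ cox_m s t = 2%N, A s t = 0 & A t s = 0],
        [/\ cox_m s t = 3%N, A s t = -1 & A t s = -1],
        [/\ cox_m s t = 4%N, A s t = -1 & A t s = -2]
      | [/\ cox_m s t = 4%N, A s t = -2 & A t s = -1]].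

Variable A : S -> S -> int.
Hypothesis cA : cartan A.
Implicit Types (u v x y : seq S) (r s t : S) (f g : S -> int).

Definition fire s f : S -> int := fun t => f t - A s t * f s.
Definition play f u : S -> int := foldl (fun g s => fire s g) f u.

Lemma play_cat f u v : play f (u ++ v) = play (play f u) v.
Proof. exact: foldl_cat. Qed.

Lemma play_rcons f u s : play f (rcons u s) = fire s (play f u).
Proof. exact: foldl_rcons. Qed.

Lemma cox_m_cases s t : s != t -> cox_m s t \in [:: 2; 3; 4]%N.
Proof. by case: cA => _ /(_ s t) H /H [] [-> _ _]. Qed.

Lemma play_dihedral s t f : play f (flatten (nseq (cox_m s t) [:: s; t])) = f.
Proof.
case: cA => A2 Ast; apply/funext => r.
case: (eqVneq s t) => [<-|/Ast H].
  have /eqP -> : cox_m s s == 1%N by rewrite cox_m_eq1.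
  by rewrite /play /= /fire A2; ring.
by case: H => -[-> st ts]; rewrite /play /= /fire !A2 !st !ts; ring.
Qed.

Lemma play_cox_eq u v : u =W v -> forall f, play f u = play f v.
Proof.
elim=> // [x y z _ IH1 _ IH2 f|x y s t f].
  by rewrite IH1 IH2.
by rewrite !play_cat play_dihedral.
Qed.

Lemma play_revK u f : play (play f u) (rev u) = f.
Proof. by rewrite -play_cat (play_cox_eq (cox_eq_revr u)). Qed.

Lemma play_Krev u f : play (play f (rev u)) u = f.
Proof. by rewrite -play_cat (play_cox_eq (cox_eq_revl u)). Qed.

Lemma play_linear u (a b : int) f g :
  play (fun t => a * f t + b * g t) u = fun t => a * play f u t + b * play g u t.
Proof.
elim/last_ind: u => // u s IH; rewrite !play_rcons IH.
by apply/funext => t; rewrite /fire; ring.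
Qed.

Definition nonneg f := forall t, 0 <= f t.

(** On the two nodes of a dihedral diagram, an alternating game shorter than
    the longest element that does not end at [s] leaves [s] nonnegative. *)
Lemma play_alt_ge0 s t k g : s != t -> (k < cox_m s t)%N ->
  0 <= g s -> 0 <= g t -> 0 <= play g (alt t s k) s.
Proof.
case: cA => A2 Ast /Ast [] [-> st ts];
  case: k => [|[|[|[|k]]]] //= _ gs gt; rewrite /play /= /fire ?A2 ?st ?ts; lia.
Qed.

(** The functional [f |-> play f u s] is the root obtained by moving the simple
    root of [s] by the element of [u]; this is the positivity half of Tits'
    theorem.  If [t] is the last letter of [u], the dihedral decomposition for
    [s] and [t] reduces it to a shorter word and the rank two computation. *)
Lemma play_ge0 u s f : reduced (rcons u s) -> nonneg f -> 0 <= play f u s.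
Proof.
move=> + f0; have [n] := ubnP (size u); elim: n u s => // n IH u s /ltnSE le_un rus.
case/lastP: u => [|u' t] in le_un rus *; first exact: f0.
have ts : t != s.
  by apply: contra_notN (@not_reduced_rcons2 _ u' t) => /eqP {2}->.
set u := rcons u' t in le_un rus *; have ru := reduced_rcons rus.
have [v [d [uv sz d_st rs rt]]] := dihedral_decomposition s t ru.
have lt_vn : (size v < n)%N.
  suff : d <> [::] by case: d sz {uv d_st} => //= a d sz _; lia.
  move=> d0; move: uv sz; rewrite d0 cats0 addn0 => uv sz.
  have := rt _ (cox_eq_trans (cox_eq_rcons t (cox_eq_sym uv)) (cox_eq_rcons2 _ t)).
  by move: sz; rewrite /u !size_rcons; lia.
have rds : reduced (rcons d s).
  apply: (@reduced_catr _ v); rewrite -rcons_cat.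
  apply: reduced_eq rus (cox_eq_rcons s uv) _.
  by move: sz; rewrite !size_rcons size_cat; lia.
rewrite (play_cox_eq uv) play_cat.
have gs := IH _ _ lt_vn rs; have gt := IH _ _ lt_vn rt.
have st : s != t by rewrite eq_sym.
have [ed|ed] := reduced_alternates st d_st (reduced_rcons rds).
  case: (size d) ed => [|k] ed; first by rewrite ed.
  by move: rds; rewrite ed => /not_reduced_rcons2.
rewrite ed; apply: play_alt_ge0 => //; rewrite ltnNge; apply/negP => le_m.
case: (@not_reduced_alt _ s t (size d).+1 (cox_m_cases st)) => //.
by rewrite /= -ed.
Qed.

Lemma play_le0 u s f : reduced u -> ~ reduced (rcons u s) -> nonneg f ->
  play f u s <= 0.
Proof.
move=> ru nr f0; have [v [uv _ rv]] := not_reduced_rcons ru nr.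
rewrite (play_cox_eq uv) play_rcons /fire cA.1.
by have := play_ge0 rv f0; lia.
Qed.

Lemma play_sign u s :
  (forall f, nonneg f -> 0 <= play f u s) \/ (forall f, nonneg f -> play f u s <= 0).
Proof.
have [v uv rv] := reduced_ex u.
have E f : play f u s = play f v s by rewrite (play_cox_eq uv).
have [r|nr] := pselect (reduced (rcons v s)); [left|right] => f f0; rewrite E.
  exact: play_ge0.
exact: play_le0.
Qed.

(** A linear functional that vanishes on nonnegative labellings vanishes, also
    within a coordinate subspace. *)
Lemma play_zero u (P : pred S) s :
  (forall f, nonneg f -> (forall t, P t -> f t = 0) -> play f u s = 0) ->
  forall f, (forall t, P t -> f t = 0) -> play f u s = 0.
Proof.
move=> H f fP.
pose p t := Num.max (f t) 0; pose n t := Num.max (- f t) 0.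
have -> : f = fun t => 1 * p t + -1 * n t.
  by apply/funext => t; rewrite /p /n; lia.
rewrite play_linear (H p) ?(H n) //; rewrite /p /n.
- by move=> t; lia.
- by move=> t /fP ->.
- by move=> t; lia.
- by move=> t /fP ->.
Qed.

Lemma root_attains1 u s : exists f, play f u s = 1.
Proof. by exists (play (fun=> 1) (rev u)); rewrite play_Krev. Qed.

Lemma play_nonzero u s : ~ (forall f, nonneg f -> play f u s = 0).
Proof.
move=> H; have [f] := root_attains1 u s.
by rewrite (@play_zero u xpred0) // => f0 n0 _; exact: H.
Qed.

(** The representation is faithful: a nonempty reduced word turns the simple
    root of its last letter into a negative root. *)
Lemma play_faithful u :
  (forall s f, nonneg f -> 0 <= play f u s) -> u =W [::].
Proof.
move=> pos; have [v uv rv] := reduced_ex u; case/lastP: v => // v s in uv rv *.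
case: (@play_nonzero u s) => f f0.
have := play_le0 rv (@not_reduced_rcons2 _ _ _) f0; have := pos s f f0.
by rewrite (play_cox_eq uv); lia.
Qed.

(** If one simple reflection turns the positive root of [(y, s)] negative then this
    root is simple, as it can only involve the coordinate of [a]. *)
Lemma root_simple y s a :
  (forall f, nonneg f -> 0 <= play f y s) ->
  (forall f, nonneg f -> play f (a :: y) s <= 0) ->
  forall f, play f y s = f a.
Proof.
move=> pos neg.
have zero f : f a = 0 -> play f y s = 0.
  move=> fa; apply: (@play_zero y (pred1 a)) => [g g0 ga|t /eqP -> //].
  apply: le_anti; rewrite pos // andbT.
  have <- : fire a g = g.
    by apply/funext => t; rewrite /fire (ga a) /= ?eqxx // mulr0 subr0.
  exact: neg.
pose e := fun t => (t == a)%:R : int.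
have lin f : play f y s = f a * play e y s.
  have {1}-> : f = fun t => f a * e t + 1 * (f t - f a * e t).
    by apply/funext => t; ring.
  by rewrite play_linear [X in _ + _ * X]zero ?mulr0 ?addr0 // /e /= eqxx mulr1 subrr.
have e0 : 0 <= play e y s by apply: pos => t; rewrite /e; case: (t == a).
have [g] := root_attains1 y s; rewrite lin => ge f; rewrite lin.
suff -> : play e y s = 1 by rewrite mulr1.
move: (play e y s) ge e0 => c ge c0.
have [c2|c2] := lerP 2 c; first by have [ga|ga] := lerP (g a) 0; nia.
have [c_0|//] : c = 0 \/ c = 1 by lia.
by move: ge; rewrite c_0 mulr0.
Qed.

(** A root determines its reflection. The product [z] of the two reflections
    is a transvection, and positivity of the roots moved by [z] and by its
    inverse forces it to be trivial. *)
Lemma root_reflection y s a :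
  (forall f, play f y s = f a) -> a :: y =W rcons y s.
Proof.
move=> root; pose B := play (A s) (rev y).
have refl f t : play f (rcons y s ++ rev y) t = f t - f a * B t.
  rewrite play_cat play_rcons.
  have -> : fire s (play f y) =
      fun t => 1 * play f y t + (- play f y s) * A s t.
    by apply/funext => x; rewrite /fire; ring.
  by rewrite play_linear play_revK root /B; ring.
have Ba : B a = 2 by rewrite /B -root play_Krev cA.1.
have A2 : A a a = 2 by rewrite cA.1.
pose z := a :: (rcons y s ++ rev y); pose z' := (rcons y s ++ rev y) ++ [:: a].
have zE f t : play f z t = f t + f a * (B t - A a t).
  by rewrite -[play f z]/(play (fire a f) _) refl /fire A2; ring.
have zE' f t : play f z' t = f t - f a * (B t - A a t).
  by rewrite play_cat -[LHS]/(fire a _ t) /fire !refl Ba; ring.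
have half (c : int) t : t != a ->
    (forall f, nonneg f -> 0 <= f t + f a * c) \/
    (forall f, nonneg f -> f t + f a * c <= 0) -> 0 <= c.
  move=> ta [pos|neg].
    have := pos (fun r => (r == a)%:R); rewrite eqxx (negPf ta) add0r mul1r.
    by apply=> r; case: (r == a).
  have := neg (fun r => (r == t)%:R); rewrite eqxx eq_sym (negPf ta) mul0r addr0 => H.
  have : (1 : int) <= 0 by apply: H => r; case: (r == t).
  by [].
have BA t : B t = A a t.
  have [->|ta] := eqVneq t a; first by rewrite Ba A2.
  apply/eqP; rewrite -subr_eq0 eq_le; apply/andP; split.
    rewrite -oppr_ge0; apply: (half _ t ta).
    have := play_sign z' t; case=> H; [left|right] => f /H; rewrite zE'; lia.
  apply: (half _ t ta).
  by have := play_sign z t; case=> H; [left|right] => f /H; rewrite zE.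
have z1 : z =W [::].
  by apply: play_faithful => t f f0; rewrite zE BA subrr mulr0 addr0.
have : z ++ y =W y by exact: (cox_eq_catr y z1).
rewrite /z /= -catA -cat_cons.
move=> E; have := cox_eq_catl [:: a] E => /=.
move=> /(cox_eq_trans (cox_eq_sym (cox_eq_square [::] a _))) /= E'.
apply: cox_eq_trans (cox_eq_sym E') _; rewrite -{2}[rcons y s]cats0.
exact: (cox_eq_catl _ (cox_eq_revl y)).
Qed.

(** The exchange condition, with the root that is responsible for it. *)
Lemma exchange u s : reduced u -> ~ reduced (rcons u s) ->
  exists x a y, [/\ u = x ++ a :: y, a :: y =W rcons y s
                  & forall f, play f y s = f a].
Proof.
elim: u => [|a u IH] ru nr.
  by case: nr => v /cox_eq_parity; case: v.
have ru' : reduced u by apply: (@reduced_catr _ [:: a]).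
have [r|n] := pselect (reduced (rcons u s)); last first.
  by have [x [b [y [-> E R]]]] := IH ru' n; exists (a :: x), b, y.
exists [::], a, u; have root : forall f, play f u s = f a.
  apply: root_simple => f f0; [exact: play_ge0|exact: play_le0].
by split=> //; exact: root_reflection.
Qed.

(** A legal play, in which every fired number is positive, follows a reduced
    word: an exchange would pair two firings with opposite numbers. *)
Lemma legal_reduced f u :
  (forall x s y, u = x ++ s :: y -> 0 < play f x s) -> reduced u.
Proof.
elim/last_ind: u => [|u s IH] legal; first by [].
have ru : reduced u.
  apply: IH => x t y uE; apply: (legal x t (rcons y s)).
  by rewrite uE rcons_cat.
have [//|nr] := pselect (reduced (rcons u s)).
have [x [a [y [uE _ root]]]] := exchange ru nr.
have := legal u s [::]; rewrite cats1 => /(_ erefl).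
rewrite {1}uE play_cat -[play _ (a :: y)]/(play (fire a _) y) root.
have := legal x a (rcons y s); rewrite uE rcons_cat => /(_ erefl).
by rewrite /fire cA.1; lia.
Qed.

(** A positive root has integral coordinates, not all zero, so its height is at
    least one. *)
Lemma nonneg_ge1 u s : reduced (rcons u s) -> 1 <= play (fun=> 1) u s.
Proof.
move=> r; have pos f := @play_ge0 u s f r.
have one : 0 <= play (fun=> 1) u s by apply: pos.
suff : play (fun=> 1) u s != 0 by lia.
apply/eqP => zero; apply: (@play_nonzero u s) => f f0.
pose K := \sum_t f t.
have bound t : f t <= K.
  by rewrite /K (bigD1 t) //= lerDl; apply: sumr_ge0 => ? _; exact: f0.
apply: le_anti; rewrite pos // andbT.
have := pos (fun t => K * 1 + -1 * f t).
rewrite (@play_linear _ K (-1) (fun=> 1)) zero mulr0 add0r mulN1r oppr_ge0.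
by apply=> t; have := bound t; lia.
Qed.

End NumbersGame.

(** * Powers of Coxeter elements *)

Lemma cat_eq_catl (T : eqType) (u v x y : seq T) :
  u ++ v = x ++ y -> size u <= size x -> exists2 z, x = u ++ z & v = z ++ y.
Proof.
move=> E le; have xE : x = u ++ drop (size u) x.
  rewrite -{1}(cat_take_drop (size u) x); congr (_ ++ _).
  by have := congr1 (take (size u)) E; rewrite take_size_cat // takel_cat.
exists (drop (size u) x) => //; apply/eqP.
have : u ++ v == u ++ (drop (size u) x ++ y) by rewrite E catA -xE.
by rewrite eqseq_cat // eqxx.
Qed.

Definition power (T : Type) k (u : seq T) := flatten (nseq k u).

Lemma size_power (T : Type) k (u : seq T) : size (power k u) = k * size u.
Proof. by rewrite size_flatten /shape map_nseq sumn_nseq mulnC. Qed.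

Lemma power_split (T : eqType) k (u x y : seq T) s : power k u = x ++ s :: y ->
  exists j i x' y',
    [/\ x = power j u ++ x', u = x' ++ s :: y' & y = y' ++ power i u].
Proof.
elim: k x => [|k IH] x; first by case: x.
rewrite -[power _ _]/(u ++ power k u) => E; have [lt|le] := ltnP (size x) (size u).
  have [[|a z] uE] := cat_eq_catl (esym E) (ltnW lt).
    by rewrite uE cats0 ltnn in lt.
  by case=> -> ->; exists 0, k, x, z; rewrite uE.
have [z xE /IH [j [i [x' [y' [zE uE yE]]]]]] := cat_eq_catl E le.
by exists j.+1, i, x', y'; rewrite xE zE catA.
Qed.

Section Coxeter.
Import Order.TTheory GRing.Theory Num.Theory.
Local Open Scope ring_scope.
Variables (M : coxeterMatrix) (A : cox_gen M -> cox_gen M -> int).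
Local Notation S := (cox_gen M).
Hypothesis cA : cartan A.
Variable lam : S -> int.
Hypothesis lam_gt0 : forall s, 0 < lam s.
Hypothesis lamA : forall t, \sum_s lam s * A s t = 0.
Implicit Types (u x y : seq S) (s t a : S).

(** An arrangement [y] of the generators orients each edge of the diagram from the
    earlier to the later letter; the label of [t] counts its edges with weights
    from [lam], outgoing ones positively and incoming ones negatively. *)
Definition flow y t : int :=
  \sum_(s | s != t) (-1) ^+ (index t y < index s y)%N * (lam s * A s t).

Lemma flow_head a y : flow (a :: y) a = 2 * lam a.
Proof.
have := lamA a; rewrite (bigD1 a) //= cA.1 => E.
rewrite /flow (eq_bigr (fun s => - (lam s * A s a))) ?sumrN; last first.
  by move=> s sa; rewrite /= eqxx eq_sym (negPf sa) mulN1r.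
by rewrite -(addr0_eq E) opprK mulrC.
Qed.

(** Firing the source [a] reverses its edges, because [lam] is in the left kernel
    of the Cartan matrix. *)
Lemma fire_flow a y : uniq (a :: y) -> (forall s, s \in a :: y) ->
  fire A a (flow (a :: y)) = flow (rcons y a).
Proof.
move=> /[dup] uay /= /andP [ay uy] full; apply/funext => t.
have iy s : s != a -> (index s (rcons y a) = index s y /\ index s y < size y)%N.
  move=> sa; have := full s; rewrite inE (negPf sa) /= => sy.
  by rewrite -cats1 index_cat sy index_mem sy.
have ia : index a (rcons y a) = size y.
  by rewrite -cats1 index_cat (negPf ay) /= eqxx addn0.
rewrite /fire flow_head //; have [->|ta] := eqVneq t a.
  have -> : flow (rcons y a) a = - (2 * lam a); last by rewrite flow_head // cA.1; ring.
  rewrite -(flow_head a y) /flow -sumrN; apply: eq_bigr => s sa.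
  have [-> lt_s] := iy s sa.
  by rewrite ia ltnNge (ltnW lt_s) /= eqxx eq_sym (negPf sa) mulN1r opprK mul1r.
have jy s : s != a -> index s (a :: y) = (index s y).+1.
  by move=> sa; rewrite /= eq_sym (negPf sa).
have [it lt_t] := iy t ta; have at_ : a != t by rewrite eq_sym.
rewrite /flow (bigD1 a) // [in RHS](bigD1 a) // it ia lt_t jy // index_head.
rewrite (eq_bigr (fun s => (-1) ^+ (index t y < index s (rcons y a))%N *
    (lam s * A s t))); first by rewrite /=; ring.
by move=> s /andP [_ sa]; have [-> _] := iy s sa; rewrite jy.
Qed.

Lemma play_flow x y : uniq (x ++ y) -> (forall s, s \in x ++ y) ->
  play A (flow (x ++ y)) x = flow (y ++ x).
Proof.
elim: x y => [|a x IH] y uxy full; first by rewrite cats0.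
rewrite -[LHS]/(play A (fire A a (flow (a :: x ++ y))) x) fire_flow // rcons_cat.
rewrite IH; first by rewrite cat_rcons.
  by rewrite -rcons_cat rcons_uniq; rewrite cat_cons cons_uniq in uxy.
by move=> s; rewrite -rcons_cat mem_rcons; exact: full.
Qed.

(** Playing [u] from its own flow fires sources only and returns to the start, so
    the game stays legal forever. *)
Lemma coxeter_power_reduced u k : uniq u -> (forall s, s \in u) ->
  reduced (power k u).
Proof.
move=> uu full; apply: (legal_reduced cA (f := flow u)) => x s y.
have loop j : play A (flow u) (power j u) = flow u.
  elim: j => // j IH; rewrite -[power _ _]/(u ++ power j u) play_cat.
  by have := @play_flow u [::]; rewrite cats0 => ->.
move=> /power_split [j [i [x' [y' [-> uE _]]]]]; rewrite play_cat loop.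
by rewrite uE play_flow -?uE // cat_cons flow_head pmulr_rgt0.
Qed.
End Coxeter.

(** * Finiteness of proper parabolic subgroups *)

Section Dirichlet.
Import Order.TTheory GRing.Theory Num.Theory.
Local Open Scope ring_scope.
Variables (T : finType) (e : rel T) (o : T).
Hypothesis e_conn : forall a, connect e o a.

Lemma potential_le (y : T -> rat) (eps : rat) : 0 <= eps -> y o = 0 ->
  (forall a b, e a b -> y b - y a <= eps) -> forall a, y a <= #|T|%:R * eps.
Proof.
move=> eps0 y0 step a; have /connectP [p0 e0 ->] := e_conn a.
case/shortenP: e0 => p ep up _.
have le_p : (size p <= #|T|)%N.
  by apply: ltnW; rewrite -[(size p).+1]/(size (o :: p)) -(card_uniqP up) max_card.
suff H : y (last o p) <= y o + (size p)%:R * eps.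
  by apply: le_trans H _; rewrite y0 add0r ler_wpM2r // ler_nat.
elim: p {up le_p} (o) ep => [|b p IH] c /=; first by rewrite mul0r addr0.
move=> /andP [/step cb /IH]; rewrite -natr1; nra.
Qed.

(** A potential that vanishes at [o] is bounded as soon as its Dirichlet energy
    is dominated by a linear function of it: some edge carries a fair share of
    the maximum, and the energy is quadratic. *)
Lemma dirichlet_bound (w : T -> T -> rat) (K : rat) (y : T -> rat) :
  (forall a b, 0 <= w a b) -> (forall a b, e a b -> 1 <= w a b) ->
  0 <= K -> y o = 0 -> (forall a, 0 <= y a) ->
  \sum_a \sum_b w a b * (y a - y b) ^+ 2 <= K * \sum_a y a ->
  forall a, y a <= K * #|T|%:R * (#|T|.+1%:R) ^+ 2.
Proof.
move=> w0 w1 K0 yo y0 energy a.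
have [m _ ym] := @Order.TotalTheory.arg_maxP _ _ _ o xpredT y isT.
apply: le_trans (ym a isT) _; set N : rat := #|T|%:R; set N1 : rat := _.+1%:R.
have N1E : N1 = N + 1 by rewrite /N1 -natr1.
have N0 : 0 <= N by rewrite ler0n.
rewrite leNgt; apply/negP => big; set Y := y m in ym big *.
have Y0 : 0 < Y by apply: le_lt_trans big; rewrite !mulr_ge0 // exprn_ge0 //; lra.
have sumY : \sum_a y a <= N * Y.
  rewrite /N -sum1_card natr_sum mulr_suml; apply: ler_sum => b _.
  by rewrite mul1r; exact: ym.
have N1_gt0 : 0 < N1 by lra.
have [|/existsNP [b /existsNP [c /not_implyP [bc /negP]]]] :=
    pselect (forall a b, e a b -> y b - y a <= Y / N1).
  move=> /(potential_le (ltW (divr_gt0 Y0 N1_gt0)) yo) /(_ m).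
  rewrite -/Y -/N mulrA ler_pdivlMr // N1E; nra.
rewrite -ltNge ltr_pdivrMr // => gap.
have : (y b - y c) ^+ 2 <= K * (N * Y).
  apply: le_trans (le_trans energy _); last by rewrite ler_wpM2l.
  rewrite (bigD1 b) //= (bigD1 c) //=.
  have := w1 _ _ bc; have := sqr_ge0 (y b - y c).
  have rest1 : 0 <= \sum_(i | i != c) w b i * (y b - y i) ^+ 2.
    by apply: sumr_ge0 => i _; rewrite mulr_ge0 ?sqr_ge0.
  have rest2 : 0 <= \sum_(i | i != b) \sum_j w i j * (y i - y j) ^+ 2.
    by apply: sumr_ge0 => i _; apply: sumr_ge0 => j _; rewrite mulr_ge0 ?sqr_ge0.
  nra.
have : Y ^+ 2 < ((y c - y b) * N1) ^+ 2 by rewrite ltr_pXn2r // nnegrE; lra.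
have : K * N * N1 ^+ 2 * Y < Y ^+ 2 by rewrite expr2 ltr_pM2r.
rewrite exprMn -[(y b - y c) ^+ 2]sqrrN opprB.
have : 0 < N1 ^+ 2 by rewrite exprn_gt0.
nra.
Qed.
End Dirichlet.

Section Parabolic.
Import Order.TTheory GRing.Theory Num.Theory.
Local Open Scope ring_scope.
Variables (M : coxeterMatrix) (A : cox_gen M -> cox_gen M -> int).
Local Notation S := (cox_gen M).
Hypothesis cA : cartan A.
Variables lam d : S -> int.
Hypothesis lam_gt0 : forall s, 0 < lam s.
Hypothesis lamA : forall t, \sum_s lam s * A s t = 0.
Hypothesis d_gt0 : forall s, 0 < d s.
Hypothesis dA : forall s t, d s * A t s = d t * A s t.
Hypothesis conn : forall s t : S, connect (fun a b => 2 < cox_m a b)%N s t.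
Implicit Types (u x y : seq S) (s t a b o : S) (c : S -> int).

(** The invariant bilinear form, symmetrized by [d]. *)
Definition bil c c' : int := \sum_a \sum_b c a * c' b * (d a * A b a).

Lemma bil_delta c s : bil (fun a => (a == s)%:R) c = d s * \sum_b c b * A b s.
Proof.
rewrite /bil (bigD1 s) //= [X in _ + X]big1 ?addr0.
  by rewrite mulr_sumr; apply: eq_bigr => b _; rewrite eqxx mul1r; ring.
by move=> a /negPf ->; rewrite big1 // => b _; rewrite !mul0r.
Qed.

Lemma bilC c c' : bil c c' = bil c' c.
Proof.
rewrite /bil exchange_big; apply: eq_bigr => a _; apply: eq_bigr => b _.
by rewrite dA; ring.
Qed.

Lemma bilD c1 c2 h c' :
  bil (fun a => c1 a + h * c2 a) c' = bil c1 c' + h * bil c2 c'.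
Proof.
rewrite /bil mulr_sumr -big_split; apply: eq_bigr => a _.
by rewrite mulr_sumr -big_split; apply: eq_bigr => b _ /=; ring.
Qed.

(** The total amounts fired along a game that starts from all ones: a reduced
    word fires at least one unit at each step, and the energy is invariant. *)
Lemma fired_amounts u : reduced u ->
  exists c, [/\ forall a, 0 <= c a, forall a, a \notin u -> c a = 0,
    (size u)%:R <= \sum_a c a,
    forall t, play A (fun=> 1) u t = 1 - \sum_a c a * A a t
  & bil c c = 2 * \sum_a d a * c a].
Proof.
elim/last_ind: u => [|u s IH] ru.
  exists (fun=> 0); split=> //; first by rewrite big1.
    by move=> t; rewrite big1 ?subr0 // => a _; rewrite mul0r.
  rewrite /bil !big1 ?mulr0 // => a _; rewrite ?mulr0 //.
  by rewrite big1 // => b _; rewrite !mul0r.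
have [c [c0 c_u c_sz cE c_en]] := IH (reduced_rcons ru).
pose h := play A (fun=> 1) u s; have h1 : 1 <= h := nonneg_ge1 cA ru.
pose e a : int := (a == s)%:R; pose c' a : int := c a + h * e a.
have sum_e (F : S -> int) : \sum_a F a * e a = F s.
  rewrite (bigD1 s) //= big1 ?addr0 /e ?eqxx ?mulr1 // => a /negPf ->.
  by rewrite mulr0.
exists c'; split.
- by move=> a; rewrite /c' /e; have := c0 a; case: (a == s) => /=; lia.
- move=> a; rewrite mem_rcons inE negb_or /c' /e => /andP [/negPf -> /c_u ->].
  by rewrite mulr0.
- rewrite size_rcons -natr1 /c' big_split /=.
  have -> : \sum_a h * e a = h by exact: (sum_e (fun=> h)).
  exact: lerD.
- move=> t; rewrite play_rcons /fire cE -/h /c'.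
  rewrite [X in _ = 1 - X](eq_bigr (fun a => c a * A a t + (h * A a t) * e a));
    last by move=> a _; ring.
  by rewrite big_split /= sum_e; ring.
have eE : bil e = bil (fun a => (a == s)%:R) by [].
have -> : bil c' c' = bil c c + 2 * h * bil e c + h ^+ 2 * bil e e.
  by rewrite (bilD c e h) ![bil _ c']bilC !(bilD c e h) (bilC c e); ring.
rewrite {}eE !bil_delta c_en.
rewrite [X in _ = 2 * X](eq_bigr (fun a => d a * c a + (d a * h) * e a)); last first.
  by move=> a _; rewrite /c'; ring.
rewrite big_split /= sum_e.
have -> : \sum_b (b == s)%:R * A b s = 2 :> int.
  by rewrite (eq_bigr (fun b => A b s * e b)) ?sum_e ?cA.1 // => b _; rewrite mulrC.
by rewrite /h cE; ring.
Qed.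

Lemma cartan_le0 s t : s != t -> A s t <= 0.
Proof. by case: cA => _ H /H [] [_ -> _]. Qed.

Lemma cartan_linked s t : (2 < cox_m s t)%N -> A s t <= -1.
Proof.
have [<-|] := eqVneq s t.
  by have /eqP -> : cox_m s s == 1%N by rewrite cox_m_eq1.
by case: cA => _ H /H [] [-> -> _].
Qed.

(** In the coordinates relative to [lam] the diagonal terms of the form cancel,
    and only differences along edges remain. *)
Lemma energy_dirichlet c (y : S -> rat) :
  (forall a, (c a)%:~R = (lam a)%:~R * y a :> rat) ->
  \sum_a \sum_b (- (d a * A b a * lam a * lam b))%:~R * (y a - y b) ^+ 2 =
  2 * (bil c c)%:~R.
Proof.
move=> cy.
have zero a : \sum_b (d a * A b a * lam a * lam b)%:~R * y a ^+ 2 = 0 :> rat.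
  rewrite -mulr_suml -rmorph_sum /=.
  have -> : \sum_b d a * A b a * lam a * lam b = d a * lam a * \sum_b lam b * A b a.
    by rewrite mulr_sumr; apply: eq_bigr => b _; ring.
  by rewrite lamA mulr0 mul0r.
have zero2 : \sum_a \sum_b (d a * A b a * lam a * lam b)%:~R * y b ^+ 2 = 0 :> rat.
  rewrite exchange_big /= big1 // => b _; rewrite -[RHS](zero b).
  by apply: eq_bigr => a _; rewrite dA; congr (_%:~R * _); ring.
transitivity (\sum_a \sum_b (2 * (c a * c b * (d a * A b a))%:~R
    - (d a * A b a * lam a * lam b)%:~R * y a ^+ 2
    - (d a * A b a * lam a * lam b)%:~R * y b ^+ 2)).
  apply: eq_bigr => a _; apply: eq_bigr => b _.
  by rewrite rmorphN !rmorphM /= !cy; ring.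
under eq_bigr do rewrite !sumrB zero subr0.
rewrite sumrB zero2 subr0 /bil rmorph_sum mulr_sumr; apply: eq_bigr => a _.
by rewrite /= rmorph_sum mulr_sumr.
Qed.

(** Proper parabolic subgroups are finite.  The invariant form is a Dirichlet
    energy, so it becomes definite once the coordinate at [o] is forced to
    vanish. *)
Lemma parabolic_bounded o : exists n : nat, forall u, reduced u -> o \notin u ->
  (size u <= n)%N.
Proof.
pose K : int := 4 * \sum_a d a * lam a.
pose C : rat := K%:~R * #|S|%:R * (#|S|.+1%:R) ^+ 2.
pose B : rat := \sum_a (lam a)%:~R * C.
have K0 : 0 <= K.
  by rewrite mulr_ge0 // sumr_ge0 // => a _; rewrite mulr_ge0 // ltW.
exists (Num.bound B) => u /fired_amounts [c [c0 c_u c_sz _ c_en]] ou.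
pose y a : rat := (c a)%:~R / (lam a)%:~R.
have lam0 a : 0 < (lam a)%:~R :> rat by rewrite ltr0z.
have cy a : (c a)%:~R = (lam a)%:~R * y a.
  by rewrite /y mulrC divfK // gt_eqF.
have y0 a : 0 <= y a by rewrite divr_ge0 ?ler0z // ltW.
have yC a : y a <= C.
  pose w a b : rat := if a == b then 0 else (- (d a * A b a * lam a * lam b))%:~R.
  have dl t : 1 <= d t * lam t by have := d_gt0 t; have := lam_gt0 t; nia.
  apply: (@dirichlet_bound _ (fun a b => 2 < cox_m a b)%N o (conn o) w) => //.
  - move=> {}a b; rewrite /w; case: eqP => // /eqP ab; rewrite ler0z.
    have := dl a; have := lam_gt0 b; have := @cartan_le0 b a; rewrite eq_sym ab.
    by move=> /(_ isT); nia.
  - move=> {}a b ab; rewrite /w.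
    have [ab'|_] := eqVneq a b.
      by move: ab; rewrite ab' (eqP (_ : cox_m b b == 1%N)) ?cox_m_eq1.
    rewrite ler1z; have := dl a; have := lam_gt0 b; have := @cartan_linked b a.
    by rewrite cox_m_sym => /(_ ab); nia.
  - by rewrite ler0z.
  - by rewrite /y c_u ?mul0r.
  have -> : \sum_a \sum_b w a b * (y a - y b) ^+ 2 = 2 * (bil c c)%:~R.
    rewrite -(energy_dirichlet cy); apply: eq_bigr => t _; apply: eq_bigr => b _.
    by rewrite /w; case: eqP => // ->; rewrite subrr expr0n !mulr0.
  rewrite c_en rmorphM rmorph_sum /= mulr_sumr !mulr_sumr; apply: ler_sum => t _.
  rewrite rmorphM /= cy /K !rmorphM /=.
  have : (d t * lam t)%:~R <= (\sum_a d a * lam a)%:~R :> rat.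
    rewrite ler_int (bigD1 t) //= lerDl; apply: sumr_ge0 => b _.
    by have := dl b; lia.
  by rewrite !rmorphM /=; have := y0 t; nra.
have c_B : (\sum_a c a)%:~R <= B.
  rewrite rmorph_sum; apply: ler_sum => a _ /=; rewrite cy ler_wpM2l // ltW //.
have le_B : (size u)%:R <= B.
  by apply: le_trans c_B; rewrite -(@rmorph_nat _ _ (intr : int -> rat)) ler_int.
have B0 : 0 <= B by apply: le_trans le_B; rewrite ler0n.
have := le_lt_trans le_B (archi_boundP B0).
by rewrite ltr_nat => /ltnW.
Qed.
End Parabolic.

(** * Words without squares and braids up to commutation *)

Lemma cat_cons_inj (T : eqType) (s : T) a b a' b' :
  a ++ s :: b = a' ++ s :: b' -> count_mem s a = count_mem s a' ->
  a = a' /\ b = b'.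
Proof.
elim: a a' => [|x a IH] [|x' a'] /=; first by case.
- by case=> <- _; rewrite eqxx.
- by case=> -> _; rewrite eqxx.
- by case=> <- /IH E /addnI /E [-> ->].
Qed.

Lemma nth_occurrence (T : eqType) (s : T) y i : i < count_mem s y ->
  exists a b, y = a ++ s :: b /\ count_mem s a = i.
Proof.
elim: y i => // x y IH i /=; have [->|xs] := eqVneq x s; last first.
  rewrite add0n => /IH [a [b [-> <-]]]; exists (x :: a), b.
  by rewrite /= (negPf xs).
case: i => [_|i]; first by exists [::], y.
rewrite add1n ltnS => /IH [a [b [-> <-]]]; exists (s :: a), b.
by rewrite /= eqxx.
Qed.

Lemma first_occurrence (T : eqType) (s : T) y : s \in y ->
  exists a b, y = a ++ s :: b /\ s \notin a.
Proof.
rewrite -has_pred1 has_count => /nth_occurrence [a [b [-> a0]]].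
by exists a, b; split=> //; rewrite -has_pred1 has_count a0.
Qed.

Section FullyCommutative.
Variables (M : coxeterMatrix) (A : cox_gen M -> cox_gen M -> int).
Local Notation S := (cox_gen M).
Local Notation "u =W v" := (@cox_eq M u v) (at level 70).
Local Notation "u ~c v" := (@comm_equiv M u v) (at level 70).
Hypothesis cA : cartan A.
Implicit Types (p q u v x y G H R : seq S) (r s t a b : S).

Definition linked s t := 2 < cox_m s t.

Lemma linkedC s t : linked s t = linked t s.
Proof. by rewrite /linked cox_m_sym. Qed.

Lemma linked_irr s : linked s s = false.
Proof. by rewrite /linked (eqP (_ : cox_m s s == 1%N)) ?cox_m_eq1. Qed.

Lemma linked_neq s t : linked s t -> s != t.
Proof. by apply: contraTneq => ->; rewrite linked_irr. Qed.

Lemma linked_m s t : linked s t -> cox_m s t = 3 \/ cox_m s t = 4.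
Proof.
move=> st; have := cox_m_cases cA (linked_neq st).
rewrite !inE => /or3P [] /eqP m; move: st; rewrite /linked m // => _; auto.
Qed.

Lemma not_linked_m s t : s != t -> ~~ linked s t -> cox_m s t = 2.
Proof.
move=> /(cox_m_cases cA); rewrite /linked !inE.
by case/or3P => /eqP ->.
Qed.

(** The representation separates [s t] from [t s] for a linked pair, which the
    presentation alone does not show. *)
Lemma commute_gen s t : commute (gen_elt s) (gen_elt t) <-> ~~ linked s t.
Proof.
have E a b : (gen_elt a * gen_elt b)%g = word_elt [:: a; b].
  by rewrite /word_elt !big_cons big_nil mulg1.
rewrite /commute !E word_eltP; split=> [st|].
  apply/negP=> lst; have := linked_neq lst.
  have /(congr1 (fun f => f s)) := play_cox_eq cA st (fun r => Posz (r == t)).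
  rewrite /play /= /fire cA.1 eqxx => H ts; move: H lst.
  rewrite (negPf ts) /linked.
  by case: (cA.2 s t ts) => -[-> -> ->].
have [<- _|st /(not_linked_m st) m2] := eqVneq s t; first exact: cox_eq_refl.
have := cox_eq_braid (cox_m_cases cA st); rewrite m2 /= => H.
exact: cox_eq_sym.
Qed.

Lemma cc_trans u v x : u ~c v -> v ~c x -> u ~c x.
Proof.
by elim=> // {}u {}v y s t st _ IH /IH; exact: comm_equiv_step.
Qed.

Lemma cc_swap p q s t : ~~ linked s t -> p ++ [:: s; t] ++ q ~c p ++ [:: t; s] ++ q.
Proof.
by move=> /commute_gen st; apply: comm_equiv_step st _; exact: comm_equiv_refl.
Qed.

Lemma cc_ind (P : seq S -> seq S -> Prop) :
  (forall u, P u u) ->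
  (forall p q v s t, ~~ linked s t -> P (p ++ [:: t; s] ++ q) v ->
     P (p ++ [:: s; t] ++ q) v) ->
  forall u v, u ~c v -> P u v.
Proof.
move=> P0 Pstep u v; elim=> // {}u {}v x s t /commute_gen st _.
exact: Pstep.
Qed.

Lemma cc_sym u v : u ~c v -> v ~c u.
Proof.
elim/cc_ind=> [{}u|p q {}v s t st IH]; first exact: comm_equiv_refl.
by apply: cc_trans IH _; apply: cc_swap; rewrite linkedC.
Qed.

Lemma cc_cat x y u v : u ~c v -> x ++ u ++ y ~c x ++ v ++ y.
Proof.
elim/cc_ind=> [{}u|p q {}v s t st IH]; first exact: comm_equiv_refl.
apply: cc_trans IH.
by have := @cc_swap (x ++ p) (q ++ y) s t st; rewrite -!catA.
Qed.

Lemma cc_rcons u v s : u ~c v -> rcons u s ~c rcons v s.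
Proof. by rewrite -!cats1 => /(@cc_cat [::] [:: s]). Qed.

Lemma cc_perm u v : u ~c v -> perm_eq u v.
Proof.
elim/cc_ind=> // p q {}v s t _; apply: perm_trans.
by rewrite perm_cat2l perm_cat2r (perm_catC [:: s] [:: t]).
Qed.

Lemma cc_size u v : u ~c v -> size u = size v.
Proof. by move/cc_perm/perm_size. Qed.

Lemma cc_cox_eq u v : u ~c v -> u =W v.
Proof.
elim/cc_ind=> [{}u|p q {}v s t /commute_gen st]; first exact: cox_eq_refl.
apply: cox_eq_trans; apply: cox_eq_catl; apply: cox_eq_catr.
by apply/word_eltP; rewrite /word_elt !big_cons big_nil !mulg1; exact: st.
Qed.

(** The two letters of a linked pair are never swapped. *)
Lemma cc_filter u v a b : u ~c v -> linked a b ->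
  filter (pred2 a b) u = filter (pred2 a b) v.
Proof.
move=> uv ab; elim/cc_ind: uv => // p q {}v s t st <-.
rewrite !filter_cat; congr (_ ++ (_ ++ _)) => /=.
have : (s == a) || (s == b) -> (t == a) || (t == b) -> s = t.
  by case/orP=> /eqP sE /orP [] /eqP tE; move: st;
    rewrite sE tE // ?[linked b a]linkedC ab.
case: ifP => [s_ab|_]; case: ifP => [t_ab|_] // E; by rewrite E.
Qed.

Lemma cc_move s G R : ~~ has (linked s) G -> s :: G ++ R ~c G ++ s :: R.
Proof.
elim: G => [|a G IH] /=; first by move=> _; exact: comm_equiv_refl.
rewrite negb_or => /andP [sa /IH E].
apply: cc_trans (@cc_swap [::] (G ++ R) s a sa) _.
by have := @cc_cat [:: a] [::] _ _ E; rewrite /= !cats0.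
Qed.

(** Stembridge's criterion for a word to be a reduced word of a fully commutative
    element. *)
Definition clean u := forall v, u ~c v ->
  (forall p s q, v <> p ++ [:: s; s] ++ q) /\
  (forall p s t q, linked s t -> v <> p ++ alt s t (cox_m s t) ++ q).

Lemma clean_cc u v : clean u -> u ~c v -> clean v.
Proof. by move=> cu uv x /(cc_trans uv); exact: cu. Qed.

Lemma clean_catl u v : clean (u ++ v) -> clean u.
Proof.
move=> cuv x /(@cc_cat [::] v) /cuv [sq br].
split=> [p s q xE|p s t q st xE]; first by apply: (sq p s (q ++ v)); rewrite xE -!catA.
by apply: (br p s t (q ++ v) st); rewrite xE -!catA.
Qed.

(** Tits' word theorem for fully commutative elements.  If both [s] and [t] are
    last letters of reduced words of the element, then so are the two longest
    words of the dihedral subgroup; for a linked pair, induction makes a braid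
    appear in the commutation class. *)
Lemma clean_matsumoto u : clean u ->
  reduced u /\ forall v, reduced v -> u =W v -> u ~c v.
Proof.
have [n] := ubnP (size u); elim: n u => // n IH u /ltnSE le_un cu.
case/lastP: u => [|u s] in le_un cu *.
  split=> // v rv uv; have := rv _ (cox_eq_sym uv).
  by case: v {rv uv} => // _; exact: comm_equiv_refl.
rewrite size_rcons in le_un.
have cu' : clean u by move: cu; rewrite -cats1; exact: clean_catl.
have [ru uniq_u] := IH u le_un cu'.
have rus : reduced (rcons u s).
  have [//|nr] := pselect (reduced (rcons u s)).
  have [v [uv _ rv]] := not_reduced_rcons ru nr.
  have := cc_rcons s (uniq_u _ rv uv) => /cu [sq _].
  by case: (sq v s [::]); rewrite cats0 -!cats1 -catA.
split=> // v rv uv; have sz := reduced_size rus rv uv.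
case/lastP: v => [|v t] in rv uv sz *; first by rewrite size_rcons in sz.
rewrite !size_rcons in sz; case: sz => sz.
have [st|st] := eqVneq s t.
  subst t; apply: cc_rcons; apply: uniq_u; first exact: reduced_rcons rv.
  exact: cox_eq_rconsI uv.
have [w [d [ud szd d_st rs rt]]] := dihedral_decomposition s t rus.
have rwd : reduced (w ++ d).
  by apply: reduced_eq rus ud _; rewrite size_cat szd.
have rd := reduced_catr rwd.
have m_st := cox_m_cases cA st.
have descent a : (a == s) || (a == t) ->
    forall f, nonneg f -> (play A (play A f w) d a <= 0 :> int)%R.
  move=> ast f f0; rewrite -play_cat -(play_cox_eq cA ud).
  case/orP: ast => /eqP ->; first exact: (play_le0 cA rus (@not_reduced_rcons2 _ _ _)).
  by rewrite (play_cox_eq cA uv); exact: (play_le0 cA rv (@not_reduced_rcons2 _ _ _)).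
have long : cox_m s t <= size d.
  rewrite leqNgt; apply/negP => lt_d.
  have zero a b : a != b -> (a == s) || (a == t) ->
      reduced (rcons w a) -> reduced (rcons w b) ->
      d = alt b a (size d) -> size d < cox_m a b -> False.
    move=> ab ast ra rb dE lt.
    apply: (@play_nonzero _ _ cA (w ++ d) a) => f f0.
    apply: Order.POrderTheory.le_anti; rewrite play_cat descent //= dE.
    by apply: (play_alt_ge0 cA) => //; apply: (play_ge0 cA).
  case: (reduced_alternates st d_st rd) => dE.
    by apply: (zero t s) => //; rewrite 1?eq_sym ?eqxx ?orbT // cox_m_sym.
  by apply: (zero s t) => //; rewrite eqxx.
have [z [uz szz]] : exists z, rcons u s =W z ++ alt s t (cox_m s t) /\
    size z + cox_m s t = (size u).+1.
  rewrite size_rcons in szd.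
  have [dE|dE] := reduced_alternates st d_st rd.
    have [z zE] := alt_suffix s t long; exists (w ++ z).
    rewrite -catA -zE -dE; split=> //.
    by have := congr1 size zE; rewrite !size_cat !size_alt; lia.
  have [z zE] := alt_suffix t s long; exists (w ++ z); split; last first.
    by have := congr1 size zE; rewrite !size_cat !size_alt; lia.
  apply: cox_eq_trans ud _; rewrite dE zE -catA; do 2! apply: cox_eq_catl.
  by apply: cox_eq_sym; exact: cox_eq_braid.
have rz : reduced (z ++ alt s t (cox_m s t)).
  by apply: reduced_eq rus uz _; rewrite size_rcons size_cat size_alt szz.
have cc_uz : rcons u s ~c z ++ alt s t (cox_m s t).
  have : cox_m s t != 0 by case: (cox_m s t) m_st.
  case: (cox_m s t) uz rz => // m uz rz _; rewrite -rcons_cat in uz rz *.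
  apply: cc_rcons; apply: uniq_u; first exact: reduced_rcons rz.
  exact: cox_eq_rconsI uz.
have [lst|/(not_linked_m st) m2] := boolP (linked s t).
  by have [_ /(_ z s t [::] lst)] := cu _ cc_uz; rewrite cats0.
move: uz cc_uz szz; rewrite m2 => uz cc_uz szz; apply: (cc_trans cc_uz).
have sw : z ++ alt s t 2 ~c rcons (rcons z s) t.
  rewrite -!cats1 -catA; have := @cc_swap z [::] t s; rewrite !cats0; apply.
  by rewrite /linked cox_m_sym m2.
have czs : clean (rcons z s).
  apply: (@clean_catl _ [:: t]); rewrite cats1.
  exact: clean_cc (clean_cc cu cc_uz) sw.
apply: (cc_trans sw); apply: cc_rcons.
have [|_] := IH (rcons z s) _ czs; first by rewrite size_rcons; lia.
apply; first exact: reduced_rcons rv.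
apply: (@cox_eq_rconsI _ _ _ t).
apply: cox_eq_trans uv; apply: cox_eq_sym; apply: (cox_eq_trans uz).
exact: cc_cox_eq sw.
Qed.

Lemma filter_alt s t k : filter (pred2 s t) (alt s t k) = alt s t k.
Proof.
apply/all_filterP; elim: k => [|[|k] IH] //=; first by rewrite eqxx.
suff H j : all (pred2 s t) (alt s t j) && all (pred2 s t) (alt t s j).
  by have /andP [] := H k.+2.
by elim: j => //= j /andP [jst jts]; rewrite !all_rcons jst jts /= !eqxx !orbT.
Qed.

(** Replacing a braid by its mirror image gives another reduced word, which the
    order of [s] and [t] separates from the first one. *)
Lemma clean_of_unique u : reduced u ->
  (forall v, reduced v -> u =W v -> u ~c v) -> clean u.
Proof.
move=> ru uniq_u v uv.
have rv : reduced v by apply: reduced_eq ru (cc_cox_eq uv) _; rewrite (cc_size uv).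
split=> [p s q vE|p s t q st vE].
  by apply: (@not_reduced_square M p s q); rewrite -vE.
have m_st := cox_m_cases cA (linked_neq st).
pose v' := p ++ alt t s (cox_m s t) ++ q.
have vv' : v =W v'.
  by rewrite vE; apply/cox_eq_catl/cox_eq_catr/cox_eq_braid.
have sz : size v = size v' by rewrite vE !size_cat !size_alt.
have rv' : reduced v' by apply: reduced_eq rv vv' _; rewrite sz.
have uv' := uniq_u _ rv' (cox_eq_trans (cc_cox_eq uv) vv').
have := cc_filter (cc_trans (cc_sym uv) uv') st.
rewrite vE !filter_cat => /eqP; rewrite eqseq_cat // eqxx /=.
have E : filter (pred2 s t) (alt t s (cox_m s t)) = alt t s (cox_m s t).
  by rewrite -[RHS]filter_alt; apply: eq_filter => r; rewrite /= orbC.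
rewrite E filter_alt eqseq_cat ?size_alt // => /andP [/eqP + _].
case: (cox_m s t) m_st => // m _ /= /rcons_inj [_ /eqP].
by rewrite (negPf (linked_neq st)).
Qed.

(** The gap between two consecutive occurrences of [s] keeps its content in
    letters linked to [s]. *)
Lemma cc_gap x y p s g q : x ~c y -> x = p ++ s :: g ++ s :: q -> s \notin g ->
  exists P G Q, [/\ y = P ++ s :: G ++ s :: Q, s \notin G,
    count_mem s P = count_mem s p,
    forall r, linked s r -> count_mem r P = count_mem r p
  & forall r, linked s r -> count_mem r G = count_mem r g].
Proof.
move=> xy xE sg; have cE r := permP (cc_perm xy) (pred1 r).
have g0 : count_mem s g = 0 by apply/count_memPn.
have lt_p : count_mem s p < count_mem s y.
  by rewrite -cE xE count_cat /= eqxx; lia.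
have [P [R [yE PE]]] := nth_occurrence lt_p.
have sR : s \in R.
  rewrite -has_pred1 has_count.
  have := cE s; rewrite xE yE !count_cat /= !count_cat /= eqxx PE g0.
  by rewrite add0n !add1n => /addnI [<-].
have [G [Q [RE sG]]] := first_occurrence sR.
have G0 : count_mem s G = 0 by apply/count_memPn.
have split_r r : linked s r ->
    count_mem r P = count_mem r p /\ count_mem r G = count_mem r g.
  move=> sr; have := cc_filter xy sr.
  rewrite xE yE RE !filter_cat /= eqxx /= !filter_cat /= eqxx /=.
  have cf a z : (a == s) || (a == r) ->
      count_mem a (filter (pred2 s r) z) = count_mem a z.
    move=> asr; rewrite count_filter; apply: eq_count => b /=.
    by case: eqP => //= ->; rewrite asr.
  move=> /cat_cons_inj; rewrite !cf ?eqxx // PE => /(_ erefl) [Pp].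
  move=> /cat_cons_inj; rewrite !cf ?eqxx // G0 g0 => /(_ erefl) [Gg _].
  by rewrite -(cf r P) -?(cf r G) ?eqxx ?orbT // -Pp -Gg !cf ?eqxx ?orbT.
exists P, G, Q; split=> //; first by rewrite yE RE.
  by move=> r /split_r [].
by move=> r /split_r [].
Qed.

(** In the next three lemmas, a gap with too few linked letters lets the letters
    at its ends move together to a square or a braid. *)
Lemma clean_no_pair s G R : clean (s :: G ++ s :: R) -> has (linked s) G.
Proof.
move=> c; apply/negPn/negP => sG.
have [sq _] := c _ (cc_move (s :: R) sG).
exact: (sq G s R).
Qed.

Lemma has_linkedN s G : (forall r, linked s r -> r \notin G) -> ~~ has (linked s) G.
Proof. by move=> H; apply/hasPn => r rG; apply/negP=> /H; rewrite rG. Qed.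

Lemma clean_no_triple s t G R : clean (s :: G ++ s :: R) -> linked s t ->
  cox_m s t = 3 -> count_mem t G = 1 ->
  ~ (forall r, linked s r -> r != t -> r \notin G).
Proof.
move=> c st m3 G1 only_t.
have tG : t \in G by rewrite -has_pred1 has_count G1.
have [G' [G'' [GE tG']]] := first_occurrence tG.
have tG'' : t \notin G''.
  apply/count_memPn; move: G1.
  by rewrite GE count_cat /= eqxx (count_memPn tG'); lia.
have sub r : linked s r -> r \notin G' /\ r \notin G''.
  move=> sr; have [->//|rt] := eqVneq r t.
  by have := only_t r sr rt; rewrite GE mem_cat inE !negb_or => /and3P [].
have sG' : ~~ has (linked s) G' by apply: has_linkedN => r /sub [].
have sG'' : ~~ has (linked s) G'' by apply: has_linkedN => r /sub [].
have cc1 : s :: G ++ s :: R ~c G' ++ [:: s; t] ++ G'' ++ s :: R.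
  by rewrite GE -catA; exact: (cc_move (t :: G'' ++ s :: R) sG').
have cc2 : G' ++ [:: s; t] ++ G'' ++ s :: R ~c G' ++ [:: s; t; s] ++ G'' ++ R.
  have := @cc_cat (G' ++ [:: s; t]) [::] _ _ (cc_sym (cc_move R sG'')).
  by rewrite !cats0 -!catA.
have [_ br] := c _ (cc_trans cc1 cc2).
by apply: (br G' s t (G'' ++ R) st); rewrite m3.
Qed.

Lemma clean_no_quadruple a b G1 G2 H R :
  clean (a :: G1 ++ b :: G2 ++ a :: H ++ b :: R) -> linked a b -> cox_m a b = 4 ->
  (forall r, linked a r -> r \notin G1 ++ G2) ->
  (forall r, linked b r -> r \notin G2 ++ H) -> False.
Proof.
move=> c ab m4 aG bG.
have aG1 : ~~ has (linked a) G1.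
  by apply: has_linkedN => r /aG; rewrite mem_cat negb_or => /andP [].
have aG2 : ~~ has (linked a) G2.
  by apply: has_linkedN => r /aG; rewrite mem_cat negb_or => /andP [].
have bGH : ~~ has (linked b) (G2 ++ H) by exact: has_linkedN.
have cc1 := cc_move (b :: G2 ++ a :: H ++ b :: R) aG1.
have cc2 := @cc_cat (G1 ++ [:: a; b]) [::] _ _ (cc_sym (cc_move (H ++ b :: R) aG2)).
have cc3 := @cc_cat (G1 ++ [:: a; b; a]) [::] _ _ (cc_sym (cc_move R bGH)).
rewrite !cats0 -!catA /= in cc2 cc3.
have [_ br] := c _ (cc_trans cc1 (cc_trans cc2 cc3)).
apply: (br G1 b a ((G2 ++ H) ++ R)); first by rewrite linkedC.
by rewrite cox_m_sym m4 /= -!catA.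
Qed.

End FullyCommutative.

(** * Factors of cyclic words *)

Section CyclicFactors.
Variable T : eqType.
Implicit Types (u v w x y : seq T) (s t : T).

Definition cfactor u y := exists j z, rot j u = y ++ z.

Lemma cfactor_size u y : cfactor u y -> size y <= size u.
Proof. by case=> j [z E]; rewrite -(size_rot j u) E size_cat leq_addr. Qed.

Lemma cfactor_count u y s : cfactor u y -> count_mem s y <= count_mem s u.
Proof.
case=> j [z E]; have /permP <- : perm_eq (rot j u) u by rewrite perm_rot.
by rewrite E count_cat leq_addr.
Qed.

Lemma cfactor_rot j u y : cfactor (rot j u) y -> cfactor u y.
Proof.
case=> i [z]; have [k ->] : exists k, rot i (rot j u) = rot k u.
  have [le_j|/ltnW/rot_oversize ->] := leqP j (size u); last by exists i.
  have [le_i|] := leqP i (size u); last first.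
    by move=> /ltnW; rewrite -(size_rot j u) => /rot_oversize ->; exists j.
  by rewrite rot_add_mod //; eexists.
by exists k, z.
Qed.

Lemma cfactor_sub u x y z : cfactor u (x ++ y ++ z) -> cfactor u y.
Proof.
case=> j [w E]; apply: (@cfactor_rot j); exists (size x), ((z ++ w) ++ x).
by rewrite E -!catA rot_size_cat -!catA.
Qed.

Lemma power_factor k u x y z : power k u = x ++ y ++ z -> size y <= size u ->
  cfactor u y.
Proof.
case: y => [|s y] E; first by exists 0, u; rewrite rot0.
rewrite cat_cons in E; have [_ [i [x' [y' [_ uE yE]]]]] := power_split E.
move=> le_y; exists (size x').
have -> : rot (size x') u = (s :: y') ++ x' by rewrite uE rot_size_cat.
have {}yE : (s :: y') ++ power i u = (s :: y) ++ z by rewrite /= yE.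
case: i yE => [|i]; first by rewrite cats0 => ->; exists (z ++ x'); rewrite catA.
rewrite -[power _ _]/(u ++ power i u) {1}uE => yE.
have {}yE : (s :: y) ++ z = ((s :: y') ++ x') ++ ((s :: y') ++ power i u).
  by rewrite -yE -!catA.
have [|w -> _] := cat_eq_catl yE; last by exists w.
by move: le_y; rewrite uE !size_cat /=; lia.
Qed.

(** Such a factor starts with a rotation of [u]. *)
Lemma power_cfactor k u x y z : power k u = x ++ y ++ z -> size u <= size y ->
  exists2 j, rot j u = take (size u) y & forall s, count_mem s u <= count_mem s y.
Proof.
rewrite -{1}(cat_take_drop (size u) y) -catA => /power_factor.
case=> [|j [w E]]; first by rewrite size_take_min geq_minl.
move=> le; have w0 : w = [::].
  apply/size0nil; have := congr1 size E.
  by rewrite size_rot size_cat size_takel //; lia.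
rewrite w0 cats0 in E; exists j => // s.
have /permP <- : perm_eq (rot j u) u by rewrite perm_rot.
by rewrite E -{2}(cat_take_drop (size u) y) count_cat leq_addr.
Qed.

Lemma count_gap (b : T) x : 1 < count_mem b x ->
  exists x1 y x2, x = x1 ++ (b :: y ++ b :: x2) /\ b \notin y.
Proof.
move=> gt1; have [x1 [R [xE x10]]] := nth_occurrence (ltnW gt1).
have [|y [x2 [RE by_]]] := @first_occurrence _ b R.
  rewrite -has_pred1 has_count; move: gt1.
  by rewrite xE count_cat x10 /= eqxx.
by exists x1, y, x2; rewrite xE RE.
Qed.
End CyclicFactors.

(** * Words with full support all of whose rotations are clean *)

Section Cyclic.
Variables (M : coxeterMatrix) (A : cox_gen M -> cox_gen M -> int).
Local Notation S := (cox_gen M).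
Hypothesis cA : cartan A.
Variable u : seq S.
Hypothesis clean_rot : forall j, clean (rot j u).
Implicit Types (x y G H R : seq S) (r s t a b : S).

Lemma cfactor_clean y : cfactor u y -> exists R, clean (y ++ R).
Proof. by case=> j [R E]; exists R; rewrite -E. Qed.

Lemma gap_linked s G : cfactor u (s :: G ++ [:: s]) -> has (linked s) G.
Proof.
by move=> /cfactor_clean [R]; rewrite /= -catA; exact: (clean_no_pair cA).
Qed.

Lemma gap_two s t G : cfactor u (s :: G ++ [:: s]) -> linked s t ->
  cox_m s t = 3 -> (forall r, linked s r -> r != t -> r \notin G) ->
  1 < count_mem t G.
Proof.
move=> cf st m3 only_t; have /hasP [r rG sr] := gap_linked cf.
have tG : 0 < count_mem t G.
  rewrite -has_count has_pred1; have [<- //|rt] := eqVneq r t.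
  by have := only_t r sr rt; rewrite rG.
rewrite ltn_neqAle tG andbT eq_sym; apply/eqP => t1.
have [R cR] := cfactor_clean cf.
apply: (@clean_no_triple _ _ cA s t G R _ st m3 t1 only_t).
by move: cR; rewrite /= -catA.
Qed.

Lemma no_quadruple a b G1 G2 H : cfactor u (a :: G1 ++ b :: G2 ++ a :: H ++ [:: b]) ->
  linked a b -> cox_m a b = 4 ->
  (forall r, linked a r -> r \notin G1 ++ G2) ->
  (forall r, linked b r -> r \notin G2 ++ H) -> False.
Proof.
move=> /cfactor_clean [R]; rewrite /= -!catA /= -!catA /= -!catA.
exact: (clean_no_quadruple cA).
Qed.

Hypothesis full : forall s, s \in u.
Hypothesis has_nbr : forall s, exists t, linked s t.
Hypothesis no_isolated_edge : forall s t, linked s t ->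
  exists r, (linked s r && (r != t)) || (linked t r && (r != s)).

Lemma count_full s : 0 < count_mem s u.
Proof. by rewrite -has_count has_pred1. Qed.

(** A convex chain in a power either fits in a rotation of [u], against
    [clean_rot], or winds around; in the latter case it sees all the neighbours
    of its letters, because [u] has full support. *)
Lemma winding_gap k x y s G : power k u = x ++ (s :: G ++ [:: s]) ++ y ->
  s \notin G ->
  cfactor u (s :: G ++ [:: s]) \/
  forall r, linked s r -> r \in G.
Proof.
move=> E sG; have [le|lt] := leqP (size (s :: G ++ [:: s])) (size u).
  by left; exact: power_factor E le.
right=> r sr; rewrite cat_cons -cat_rcons in E.
have [|_ _ /(_ r)] := power_cfactor E; first by move: lt; rewrite /= ltnS.
move=> /(leq_trans (count_full r)); rewrite -has_count has_pred1 mem_cat inE.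
by rewrite [r == s]eq_sym (negPf (linked_neq sr)) orbF.
Qed.

(** The only way in which a power of [u] can fail to be fully commutative: the
    end [s] of a simple edge and its neighbour [t] occur once each, so that [s],
    [t], [s] is a braid in the square of [u]. *)
Definition pendant s t :=
  [/\ linked s t, cox_m s t = 3, forall r, linked s r -> r = t,
      count_mem s u = 1 & count_mem t u = 1].

Lemma clean_power : (forall k, clean (power k u)) \/ exists s t, pendant s t.
Proof.
have [|none] := pselect (exists s t, pendant s t); [by right|left=> k v uv].
have vu := cc_sym cA uv; split=> [p s q vE|p b a q ba vE].
  have [P [G [Q [E sG _ _ G0]]]] := @cc_gap _ _ cA v _ p s [::] q vu vE isT.
  have {}E : power k u = P ++ (s :: G ++ [:: s]) ++ Q by rewrite E /= -catA.
  have noG r : linked s r -> r \notin G by move=> /G0 /count_memPn.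
  case: (winding_gap E sG) => [/gap_linked /hasP [r rG /noG]|H]; first by rewrite rG.
  by have [t /[dup] /H tG /noG] := has_nbr s; rewrite tG.
have ab : linked a b by rewrite linkedC.
case: (linked_m cA ba) => m.
  rewrite m /= in vE; have bNa : b \notin [:: a] by rewrite inE linked_neq.
  have [P [G [Q [E bG _ _ GE]]]] := @cc_gap _ _ cA v _ p b [:: a] q vu vE bNa.
  have {}E : power k u = P ++ (b :: G ++ [:: b]) ++ Q by rewrite E /= -catA.
  have a1 : count_mem a G = 1 by rewrite GE //= eqxx.
  have noG r : linked b r -> r != a -> r \notin G.
    by move=> br ra; apply/count_memPn; rewrite GE //= eq_sym (negPf ra).
  have [le|lt] := leqP (size (b :: G ++ [:: b])) (size u).
    by have := gap_two (power_factor E le) ba m noG; rewrite a1.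
  case: none; exists b, a; split=> //.
  - move=> r br; apply/eqP/negPn/negP => /(noG _ br).
    case: (winding_gap E bG) => [/cfactor_size|/(_ r br) -> //].
    by rewrite leqNgt lt.
  - rewrite cat_cons -cat_rcons in E; have [|_ _ H] := power_cfactor E.
      by move: lt; rewrite /= ltnS.
    apply/eqP; rewrite eqn_leq count_full andbT; apply: leq_trans (H b) _.
    by rewrite count_cat /= eqxx (count_memPn bG).
  - rewrite cat_cons -cat_rcons in E; have [|_ _ H] := power_cfactor E.
      by move: lt; rewrite /= ltnS.
    apply/eqP; rewrite eqn_leq count_full andbT; apply: leq_trans (H a) _.
    by rewrite count_cat /= a1 (negPf (linked_neq ba)).
rewrite m /= in vE.
have aNb : a \notin [:: b] by rewrite inE linked_neq.
have bNa : b \notin [:: a] by rewrite inE linked_neq.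
have [P [G [Q [Ea aG _ Pr Gr]]]] := @cc_gap _ _ cA v _ p a [:: b] (b :: q) vu vE aNb.
have vE' : v = rcons p a ++ b :: [:: a] ++ b :: q by rewrite vE cat_rcons.
have [P' [H [Q' [Eb bH Pb' _ Hr]]]] := @cc_gap _ _ cA v _ _ b [:: a] q vu vE' bNa.
have b1 : count_mem b G = 1 by rewrite Gr //= eqxx.
have a1 : count_mem a H = 1 by rewrite Hr //= eqxx.
have [|G1 [G2 [GE bG1]]] := @first_occurrence _ b G.
  by rewrite -has_pred1 has_count b1.
have [|H1 [H2 [HE aH1]]] := @first_occurrence _ a H.
  by rewrite -has_pred1 has_count a1.
have bG2 : b \notin G2.
  apply/count_memPn; move: b1; rewrite GE count_cat /= eqxx (count_memPn bG1).
  by rewrite add0n add1n => -[].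
have aH2 : a \notin H2.
  apply/count_memPn; move: a1; rewrite HE count_cat /= eqxx (count_memPn aH1).
  by rewrite add0n add1n => -[].
have [aG1 aG2] : a \notin G1 /\ a \notin G2.
  by move: aG; rewrite GE mem_cat inE !negb_or => /and3P [].
(* Both gaps live in the same word, so their letters interleave. *)
have [_ HG] : P' = P ++ a :: G1 /\ H ++ b :: Q' = G2 ++ a :: Q.
  apply: (@cat_cons_inj _ b); first by rewrite -Eb Ea GE -!catA /= -?catA.
  by rewrite Pb' -cats1 !count_cat /= (count_memPn bG1) Pr.
have [H1E QE] : H1 = G2 /\ H2 ++ b :: Q' = Q.
  apply: (@cat_cons_inj _ a); first by rewrite -HG HE -!catA /=.
  by rewrite (count_memPn aH1) (count_memPn aG2).
have aGr r : linked a r -> r != b -> r \notin G.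
  by move=> ar rb; apply/count_memPn; rewrite Gr //= eq_sym (negPf rb).
have bHr r : linked b r -> r != a -> r \notin H.
  by move=> br ra; apply/count_memPn; rewrite Hr //= eq_sym (negPf ra).
have E : power k u = P ++ (a :: G1 ++ b :: G2 ++ a :: H2 ++ [:: b]) ++ Q'.
  by rewrite Ea GE -QE /= -!catA /= -?catA /= -?catA.
have [le|lt] := leqP (size (a :: G1 ++ b :: G2 ++ a :: H2 ++ [:: b])) (size u).
  apply: (no_quadruple (power_factor E le) ab).
  - by rewrite cox_m_sym.
  - move=> r ar; have [->|rb] := eqVneq r b; first by rewrite mem_cat negb_or bG1.
    by have := aGr r ar rb; rewrite GE !mem_cat inE !negb_or => /and3P [-> _ ->].
  - move=> r br; have [->|ra] := eqVneq r a; first by rewrite mem_cat negb_or aG2.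
    by have := bHr r br ra; rewrite HE H1E !mem_cat inE !negb_or => /and3P [-> _ ->].
have au : count_mem a u = 1.
  apply/eqP; rewrite eqn_leq count_full andbT.
  rewrite cat_cons -cat_rcons in E; have [|_ _ /(_ a)] := power_cfactor E.
    by move: lt; rewrite /= ltnS.
  rewrite !count_cat /= !count_cat /= !count_cat /= eqxx (negPf (linked_neq ba)).
  by rewrite (count_memPn aG1) (count_memPn aG2) (count_memPn aH2).
have bu : count_mem b u = 1.
  apply/eqP; rewrite eqn_leq count_full andbT.
  have {}E : power k u = P ++ (a :: G1 ++ b :: G2 ++ a :: H2) ++ b :: Q'.
    by rewrite E /= -?catA /= -?catA /= -?catA.
  have [|_ _ /(_ b)] := power_cfactor E.
    by move: lt; rewrite /= !size_cat /= !size_cat /= !size_cat /=; lia.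
  rewrite /= !count_cat /= !count_cat /= eqxx (negPf (linked_neq ab)).
  move: bH; rewrite HE mem_cat inE !negb_or => /and3P [_ _ bH2].
  by rewrite (count_memPn bG1) (count_memPn bG2) (count_memPn bH2).
have wind s G' x y : power k u = x ++ s :: G' ++ s :: y -> s \notin G' ->
    count_mem s u = 1 -> forall r, linked s r -> r \in G'.
  move=> E' sG' s1; have [||//] := @winding_gap k x y s G' _ sG'.
    by rewrite E' /= -catA.
  by move=> /(cfactor_count s); rewrite s1 /= count_cat /= eqxx addn0 addn1 add1n.
have [r /orP [] /andP [lr rN]] := no_isolated_edge ab.
  by have := aGr r lr rN; rewrite (wind a G P Q Ea aG au).
by have := bHr r lr rN; rewrite (wind b H P' Q' Eb bH bu).
Qed.
End Cyclic.

(** * Following gaps along a path of the diagram *)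

Section CyclicPath.
Variables (M : coxeterMatrix) (A : cox_gen M -> cox_gen M -> int).
Local Notation S := (cox_gen M).
Hypothesis cA : cartan A.
Variable u : seq S.
Hypothesis clean_rot : forall j, clean (rot j u).
Hypothesis full : forall s, s \in u.
Implicit Types (x y : seq S) (r s t a b c z : S).

(** Cut the cyclic word at the unique [a]. *)
Lemma single_gap a b : count_mem a u = 1 -> 1 < count_mem b u ->
  exists x, [/\ cfactor u (b :: x ++ [:: b]), b \notin x & a \notin x].
Proof.
move=> a1 b2; have [P [R [uE aP]]] := first_occurrence (full a).
have ba : b != a by apply: contraTneq b2 => ->; rewrite a1.
have uRP : rot (size P) u = a :: R ++ P by rewrite uE rot_size_cat.
have cRP s : count_mem s u = (a == s) + count_mem s (R ++ P).
  have /seq.permP <- : perm_eq (a :: R ++ P) u by rewrite -uRP perm_rot.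
  by [].
have aRP : a \notin R ++ P.
  by apply/count_memPn; move: a1; rewrite cRP eqxx add1n => -[].
move: b2; rewrite cRP eq_sym (negPf ba) => /count_gap [x1 [y [x2 [RPE b_y]]]].
exists y; split=> //.
  apply: (@cfactor_sub _ _ (a :: x1) _ x2); exists (size P), [::].
  by rewrite uRP RPE cats0 /= -?catA.
by move: aRP; rewrite RPE mem_cat inE mem_cat !negb_or => /and4P [].
Qed.

Lemma count_leaf a z : (forall r, linked z r -> r = a) -> count_mem a u = 1 ->
  count_mem z u = 1.
Proof.
move=> leaf a1; apply/eqP; rewrite eqn_leq (count_full full) andbT leqNgt.
apply/negP => /(single_gap a1) [x [/(gap_linked cA clean_rot) /hasP [r rx /leaf ra] _]].
by rewrite -ra rx.
Qed.

Lemma adjacent_gap c x : cfactor u (c :: x ++ [:: c]) ->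
  exists y, [/\ c \notin y, cfactor u (c :: y ++ [:: c])
              & cfactor u (c :: x ++ c :: y)].
Proof.
case=> j [R]; rewrite /= -catA /= => E.
have [/first_occurrence [y [R' [RE cy]]]|cR] := boolP (c \in R).
  exists y; split=> //.
    apply: (@cfactor_sub _ _ (c :: x) _ R'); exists j, [::].
    by rewrite E RE cats0 /= -?catA.
  by exists j, (c :: R'); rewrite E RE /= -?catA.
exists R; split=> //; last by exists j, [::]; rewrite E cats0.
apply: (@cfactor_rot _ j); exists (size (c :: x)), x.
by rewrite E -cat_cons rot_size_cat /= -catA.
Qed.

(** A simple path [v 0], ..., [v m] in the diagram.  Beyond [v 0] its only
    neighbours are the leaves in [top], attached to [v m]: either one leaf on a
    double edge or two leaves on simple edges. *)
Variables (m : nat) (v : nat -> S) (top : pred S).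
Hypothesis v_m : forall i, i < m -> cox_m (v i) (v i.+1) = 3.
Hypothesis v_nbr : forall i r, 0 < i < m -> linked (v i) r ->
  r = v i.-1 \/ r = v i.+1.
Hypothesis top_nbr : forall r, 0 < m -> linked (v m) r -> r = v m.-1 \/ top r.
Hypothesis top_leaf : forall z, top z ->
  linked (v m) z /\ forall r, linked z r -> r = v m.
Hypothesis top_m :
  (exists2 z, cox_m (v m) z = 4 & forall r, top r = (r == z)) \/
  (forall z, top z -> cox_m (v m) z = 3 /\
     exists z', [/\ top z', z' != z & forall r, top r -> r = z \/ r = z']).

Lemma v_linked i : i < m -> linked (v i) (v i.+1).
Proof. by move=> /v_m; rewrite /linked => ->. Qed.

(** A gap of [v j] without [v j.-1] must contain [v j.+1] at least twice, so a gap
    of [v j.+1] without [v j]; this climbs to the top of the path. *)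
Lemma gap_up d j x : j + d = m -> 0 < j ->
  cfactor u (v j :: x ++ [:: v j]) -> v j \notin x -> v j.-1 \notin x ->
  exists x', [/\ cfactor u (v m :: x' ++ [:: v m]), v m \notin x'
               & v m.-1 \notin x'].
Proof.
elim: d j x => [|d IH] j x jd j0 cf jx jx'; first by exists x; rewrite -jd addn0.
have jm : j < m by lia.
have [|x1 [y [x2 [xE y_]]]] :=
    count_gap (gap_two cA clean_rot cf (v_linked jm) (v_m jm) _).
  move=> r jr rj; have [|->//|rE] := v_nbr _ jr; first by rewrite j0.
  by rewrite rE eqxx in rj.
apply: (IH j.+1 y) => //; first by lia.
  apply: (@cfactor_sub _ _ (v j :: x1) _ (x2 ++ [:: v j])).
  by move: cf; rewrite xE /= -?catA /= -?catA.
by move: jx; rewrite xE mem_cat inE mem_cat !negb_or => /and4P [].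
Qed.

(** Conversely a gap of [v j] in which only [v j.-1] is linked to [v j] contains a
    gap of [v j.-1] of the same kind, down to two occurrences of [v 0]. *)
Lemma gap_down j y : 0 < j <= m -> count_mem (v 0) u = 1 ->
  cfactor u (v j :: y ++ [:: v j]) -> v j \notin y ->
  (forall r, linked (v j) r -> r != v j.-1 -> r \notin y) -> False.
Proof.
move=> + v01; elim: j y => // j IH y /= jm cf jy only.
have lj : linked (v j.+1) (v j) by rewrite linkedC; exact: v_linked.
have mj : cox_m (v j.+1) (v j) = 3 by rewrite cox_m_sym; exact: v_m.
have := gap_two cA clean_rot cf lj mj only.
case: j => [|j] in IH jm cf jy lj mj only *.
  move=> gt1; have := cfactor_count (v 0) cf; rewrite v01 /= count_cat.
  by rewrite leqNgt ltn_addl // ltn_addr.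
move=> /count_gap [x1 [x [x2 [yE y_]]]].
have jx : v j.+2 \notin x.
  by move: jy; rewrite yE mem_cat inE mem_cat !negb_or => /and4P [].
apply: (IH x) => //; first by lia.
  apply: (@cfactor_sub _ _ (v j.+2 :: x1) _ (x2 ++ [:: v j.+2])).
  by move: cf; rewrite yE /= -?catA /= -?catA.
move=> r jr rj; have [|/= rE|->//] := v_nbr _ jr; first by lia.
by rewrite rE eqxx in rj.
Qed.

(** Around a gap of [v m] without [v m.-1], which must contain every leaf in
    [top], the next gap cannot contain any of them. *)
Lemma gap_top x : 0 < m -> cfactor u (v m :: x ++ [:: v m]) -> v m \notin x ->
  v m.-1 \notin x ->
  exists y, [/\ cfactor u (v m :: y ++ [:: v m]), v m \notin y
              & forall z, top z -> z \notin y].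
Proof.
set c := v m => m0 cf cx cx'; have [y [cy cfy cfxy]] := adjacent_gap cf.
exists y; split=> // z tz; apply/negP=> zy; have [lz z_leaf] := top_leaf tz.
have no_leaf_gap b g x1 x2 : top b -> x = x1 ++ (b :: g ++ b :: x2) -> False.
  move=> tb xE; have [_ b_leaf] := top_leaf tb.
  have : cfactor u (b :: g ++ [:: b]).
    apply: (@cfactor_sub _ _ (c :: x1) _ (x2 ++ [:: c])).
    by move: cf; rewrite xE /= -?catA /= -?catA.
  move=> /(gap_linked cA clean_rot) /hasP [r rg /b_leaf rE].
  move: cx; rewrite xE mem_cat inE mem_cat !negb_or => /and4P [_ _ + _].
  by rewrite -/c in rE; rewrite -rE rg.
have zx : z \in x.
  case: top_m => [[b _ topE]|/(_ z tz) [_ [z' [tz' zz' top2]]]].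
    have /hasP [r rx /(top_nbr m0) []] := gap_linked cA clean_rot cf.
      by move=> rE; move: cx'; rewrite -rE rx.
    by rewrite topE; move: tz; rewrite topE => /eqP -> /eqP <-.
  apply/negPn/negP => zx; have [lz' _] := top_leaf tz'.
  have mz' : cox_m c z' = 3.
    by case: top_m => [[b _ topE]|/(_ z' tz') []//]; move: tz tz' zz';
      rewrite !topE => /eqP -> /eqP ->; rewrite eqxx.
  have [|x1 [g [x2 [xE _]]]] := count_gap (gap_two cA clean_rot cf lz' mz' _).
    by move=> r /(top_nbr m0) [->//|/top2 [->//|->]]; rewrite eqxx.
  exact: no_leaf_gap tz' xE.
have [x1 [x2 [xE zx1]]] := first_occurrence zx.
have zx2 : z \notin x2.
  apply/negP=> /first_occurrence [g [x3 [x2E _]]].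
  by apply: (no_leaf_gap z g x1 x3 tz); rewrite xE x2E.
have [y1 [y2 [yE zy1]]] := first_occurrence zy.
have [cx2 cy1] : c \notin x2 /\ c \notin y1.
  by move: cx cy; rewrite xE yE !mem_cat !inE !negb_or => /and3P [_ _ ->] /and3P [->].
case: top_m => [[b m4 topE]|/(_ z tz) [m3 _]].
  have zb : z = b by move: tz; rewrite topE => /eqP.
  apply: (@no_quadruple _ _ cA _ clean_rot c z x1 x2 y1) => //; last 2 first.
  - move=> r /(top_nbr m0) [->|].
      by move: cx'; rewrite xE !mem_cat inE !negb_or => /and3P [-> _ ->].
    by rewrite topE -zb => /eqP ->; rewrite mem_cat negb_or zx1.
  - by move=> r /z_leaf ->; rewrite mem_cat negb_or cx2.
  - apply: (@cfactor_sub _ _ [::] _ y2).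
    by move: cfxy; rewrite xE yE /= -?catA /= -?catA /= -?catA.
  by rewrite zb.
have : cfactor u (z :: (x2 ++ c :: y1) ++ [:: z]).
  apply: (@cfactor_sub _ _ (c :: x1) _ y2).
  by move: cfxy; rewrite xE yE /= -?catA /= -?catA /= -?catA.
move=> /(gap_two cA clean_rot (t := c)); rewrite linkedC cox_m_sym => /(_ lz m3).
suff H : forall r, linked z r -> r != c -> r \notin x2 ++ c :: y1.
  by move=> /(_ H); rewrite count_cat /= eqxx (count_memPn cx2) (count_memPn cy1).
by move=> r /z_leaf ->; rewrite eqxx.
Qed.

(** If [v i.+1] occurred twice, some gap of it would avoid the single [v i]; it
    produces a gap at the top, whose neighbour descends to a second [v 0]. *)
Lemma path_count1 : count_mem (v 0) u = 1 ->
  forall i, i <= m -> count_mem (v i) u = 1.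
Proof.
move=> v01; elim=> // i IH im; apply/eqP.
rewrite eqn_leq (count_full full) andbT leqNgt; apply/negP.
move=> /(single_gap (IH (ltnW im))) [x [cf ix ix']].
have m0 : 0 < m by lia.
have [||x' [cf' mx mx']] := @gap_up (m - i.+1) i.+1 x _ _ cf ix ix'; [lia|lia|].
have [y [cfy my topy]] := gap_top m0 cf' mx mx'.
apply: (gap_down _ v01 cfy my); first by lia.
by move=> r /(top_nbr m0) [->|/topy //]; rewrite eqxx.
Qed.
End CyclicPath.

(** * Affine Cartan data *)

(** A positive vector in the left kernel of the Cartan matrix is what singles out
    the affine diagrams; the symmetrizer yields the invariant form. *)
Record affine_datum (M : coxeterMatrix) := AffineDatum {
  aff_A : cox_gen M -> cox_gen M -> int;
  aff_lam : cox_gen M -> int;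
  aff_d : cox_gen M -> int;
  aff_cartan : cartan aff_A;
  aff_lam_gt0 : forall s, (0 < aff_lam s)%R;
  aff_lamA : forall t, (\sum_s aff_lam s * aff_A s t = 0)%R;
  aff_d_gt0 : forall s, (0 < aff_d s)%R;
  aff_dA : forall s t, (aff_d s * aff_A t s = aff_d t * aff_A s t)%R;
  aff_conn : forall s t : cox_gen M, connect (fun a b => 2 < cox_m a b) s t;
  aff_card : 2 < #|cox_gen M| }.

Lemma connect_from (T : finType) (e : rel T) o : symmetric e ->
  (forall a, connect e o a) -> forall a b, connect e a b.
Proof.
move=> se co a b; apply: connect_trans (co b).
by rewrite (sym_connect_sym se).
Qed.

Section CycleDatum.
Import Order.TTheory GRing.Theory Num.Theory.
Local Open Scope ring_scope.
Variable n : nat.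
Hypothesis n_ge3 : (3 <= n)%N.

(** For at least three nodes the three terms are exclusive, and the sum of a
    column can be read off. *)
Definition cycle_A (i j : 'I_n) : int :=
  2 * (i == j)%:R - (ordS i == j)%:R - (ordS j == i)%:R.

Lemma ordS_neq (i : 'I_n) : (ordS i == i) = false.
Proof.
apply/eqP => /(congr1 val) /=; have := ltn_ord i.
rewrite leq_eqVlt => /orP [/eqP E|lt]; first by rewrite E modnn; lia.
by rewrite modn_small //; lia.
Qed.

Lemma ordS_cycle2 (i j : 'I_n) : ordS i == j -> (ordS j == i) = false.
Proof.
move=> /eqP <-; apply/eqP => /(congr1 val) /=; have := ltn_ord i.
rewrite leq_eqVlt => /orP [/eqP E|lt]; first by rewrite E modnn modn_small; lia.
rewrite (modn_small lt); move: lt.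
rewrite leq_eqVlt => /orP [/eqP E|lt]; first by rewrite E modnn; lia.
by rewrite modn_small //; lia.
Qed.

Lemma cycle_mE (i j : 'I_n) : cycle_m i j =
  if i == j then 1%N else if (ordS i == j) || (ordS j == i) then 3%N else 2%N.
Proof. by []. Qed.

Lemma cycle_cartan : @cartan (typeA n) cycle_A.
Proof.
split=> [i|i j ij]; first by rewrite /cycle_A eqxx !ordS_neq.
rewrite /= cycle_mE /cycle_A (negPf ij) [j == i]eq_sym (negPf ij).
have := @ordS_cycle2 i j; case: (ordS i == j) => [/(_ isT) ->|_] /=.
  by constructor 2.
by case: (ordS j == i) => /=; [constructor 2|constructor 1].
Qed.

Lemma cycle_sum (j : 'I_n) : \sum_i 1 * cycle_A i j = 0.
Proof.
have one (k : 'I_n) : \sum_i (i == k)%:R = 1 :> int.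
  by rewrite (bigD1 k) //= eqxx big1 ?addr0 // => i /negPf ->.
under eq_bigr do rewrite mul1r /cycle_A.
rewrite !sumrB -mulr_sumr one.
have -> : \sum_i (ordS i == j)%:R = 1 :> int.
  rewrite -(one (ord_pred j)); apply: eq_bigr => i _.
  by rewrite -{1}(ord_predK j) (inj_eq (can_inj (@ordSK n))).
by under eq_bigr do rewrite eq_sym; rewrite one.
Qed.

Lemma cycle_linked (i : 'I_n) : @linked (typeA n) i (ordS i).
Proof. by rewrite /linked /= cycle_mE eqxx eq_sym ordS_neq. Qed.

Lemma cycle_conn (i j : 'I_n) : connect (fun a b => 2 < @cox_m (typeA n) a b)%N i j.
Proof.
have n0 : (0 < n)%N by lia.
apply: (@connect_from _ _ (Ordinal n0)) => [a b|[k kn]]; first by rewrite cox_m_sym.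
elim: k kn => [|k IH] kn.
  by rewrite (_ : Ordinal kn = Ordinal n0) //; exact: val_inj.
apply: connect_trans (IH (ltnW kn)) (connect1 _).
have -> : Ordinal kn = ordS (Ordinal (ltnW kn)).
  by apply: val_inj; rewrite /= modn_small.
exact: cycle_linked.
Qed.

Definition cycle_datum : affine_datum (typeA n).
Proof.
refine (@AffineDatum (typeA n) cycle_A (fun=> 1) (fun=> 1) cycle_cartan _
  cycle_sum _ _ cycle_conn _) => //.
  by move=> s t; rewrite /cycle_A eq_sym; ring.
by rewrite card_ord.
Defined.

(** No node of the cycle is an end. *)
Lemma cycle_no_pendant u s t : ~ @pendant (typeA n) u s t.
Proof.
case=> _ _ nbr _ _.
have E1 := nbr _ (cycle_linked s).
have /nbr E2 : @linked (typeA n) s (ord_pred s).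
  by rewrite linkedC -{2}(ord_predK s) cycle_linked.
have := @ordS_cycle2 (ord_pred s) s; rewrite ord_predK eqxx => /(_ isT).
by rewrite E1 -E2 eqxx.
Qed.
End CycleDatum.

(** In both shapes the leaves at the end of the path have total weight two in the
    kernel vector, which makes the diagram affine. *)
Definition path_end (L : finType) (mL : nat) :=
  (mL = 4 /\ exists z : L, forall z', z' = z) \/
  (mL = 3 /\ exists z1 z2 : L, z1 != z2 /\ forall z, z = z1 \/ z = z2).

Lemma path_end_unit : path_end unit 4.
Proof. by left; split=> //; exists tt; case. Qed.

Lemma path_end_bool : path_end bool 3.
Proof. by right; split=> //; exists true, false; split=> // -[]; auto. Qed.

Section PathDatum.
Import Order.TTheory GRing.Theory Num.Theory.
Local Open Scope ring_scope.
Variables (N : nat) (L R : finType) (mL mR : nat).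
Hypotheses (mL_gt1 : (1 < mL)%N) (mR_gt1 : (1 < mR)%N).
Hypotheses (endL : path_end L mL) (endR : path_end R mR).
Local Notation M := (@path_matrix N.+2 L R mL mR mL_gt1 mR_gt1).
Local Notation S := (L + 'I_N.+1 + R)%type.
Local Notation node i := (inl (inr i) : S).
Local Notation lend z := (inl (inl z) : S).
Local Notation rend z := (inr z : S).

Lemma sum_path_end (T : finType) m : path_end T m ->
  \sum_(z : T) (m%:Z - 2) = 2.
Proof.
case=> -[-> [z1]].
  move=> zE; rewrite (bigD1 z1) //= big1 ?addr0 // => z.
  by rewrite (zE z) eqxx.
case=> z2 [z12 zE]; rewrite (bigD1 z1) //= (bigD1 z2) 1?eq_sym //= big1 ?addr0 //.
by move=> z; case: (zE z) => ->; rewrite eqxx ?andbF.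
Qed.

Lemma path_end_cases (T : finType) m : path_end T m -> m = 3%N \/ m = 4%N.
Proof. by case=> -[-> _]; auto. Qed.

(** On a double edge the coefficient [-2] sits in the row of the inner node; with
    this choice the kernel vector is [2] on the path for both kinds of ends. *)
Definition path_A (x y : S) : int :=
  match x, y with
  | inl (inr i), inl (inr j) =>
      2 * (i == j :> nat)%:R - (i.+1 == j :> nat)%:R - (j.+1 == i :> nat)%:R
  | inl (inl _), inl (inr i) => - (i == 0%N :> nat)%:R
  | inl (inr i), inl (inl _) => - (mL%:Z - 2) * (i == 0%N :> nat)%:R
  | inr _, inl (inr i) => - (i == N :> nat)%:R
  | inl (inr i), inr _ => - (mR%:Z - 2) * (i == N :> nat)%:R
  | inl (inl z), inl (inl z') => 2 * (z == z')%:R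
  | inr z, inr z' => 2 * (z == z')%:R
  | _, _ => 0
  end.

Definition path_lam (x : S) : int :=
  match x with inl (inl _) => mL%:Z - 2 | inl (inr _) => 2 | inr _ => mR%:Z - 2 end.

Definition path_d (x : S) : int :=
  match x with inl (inl _) => 5 - mL%:Z | inl (inr _) => 2 | inr _ => 5 - mR%:Z end.

Lemma path_cartan : @cartan M path_A.
Proof.
split=> [[[z|i]|z]|[[z|i]|z] [[z'|j]|z'] xy] /=; rewrite /path_m ?(negPf xy).
- by rewrite eqxx.
- by rewrite eqxx; case: (i : nat) => [|k]; rewrite /= ?eqxx; lia.
- by rewrite eqxx.
- have {}xy : (z == z') = false by exact: negPf xy.
  by rewrite xy [z' == z]eq_sym xy; constructor 1.
- case: eqP => _; last by constructor 1; rewrite oppr0 mulr0.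
  by case: (path_end_cases endL) => ->; [constructor 2|constructor 3].
- by constructor 1.
- case: eqP => _; last by constructor 1; rewrite oppr0 mulr0.
  by case: (path_end_cases endL) => ->; [constructor 2|constructor 4].
- have {xy} ij : i != j :> nat by exact: xy.
  rewrite [(j : nat) == i]eq_sym (negPf ij).
  case: eqP => [E|_] /=.
    by rewrite (_ : (j.+1 == i) = false); [constructor 2|apply/eqP; lia].
  by case: eqP => _; [constructor 2|constructor 1].
- rewrite -[N.+2.-1]/N.+1 eqSS; case: eqP => _; last by constructor 1; rewrite ?mulr0.
  by case: (path_end_cases endR) => ->; [constructor 2|constructor 4].
- by constructor 1.
- rewrite -[N.+2.-1]/N.+1 eqSS; case: eqP => _; last by constructor 1; rewrite ?mulr0.
  by case: (path_end_cases endR) => ->; [constructor 2|constructor 3].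
- have {}xy : (z == z') = false by exact: negPf xy.
  by rewrite xy [z' == z]eq_sym xy; constructor 1.
Qed.

Lemma path_lam_gt0 s : 0 < path_lam s.
Proof.
by case: s => [[z|i]|z] //=;
  [case: (path_end_cases endL)|case: (path_end_cases endR)] => ->.
Qed.

Lemma path_d_gt0 s : 0 < path_d s.
Proof.
by case: s => [[z|i]|z] //=;
  [case: (path_end_cases endL)|case: (path_end_cases endR)] => ->.
Qed.

Lemma path_dA s t : path_d s * path_A t s = path_d t * path_A s t.
Proof.
case: s t => [[z|i]|z] [[z'|j]|z'] //=; rewrite ?mulr0 //; try by rewrite eq_sym.
- by case: (path_end_cases endL) => ->; lia.
- by case: (path_end_cases endL) => ->; lia.
- by rewrite [(j : nat) == i]eq_sym; ring.
- by case: (path_end_cases endR) => ->; lia.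
- by case: (path_end_cases endR) => ->; lia.
Qed.

Lemma sum_ord_eq (k : nat) : \sum_(i < N.+1) (i == k :> nat)%:R = (k < N.+1)%:R :> int.
Proof.
have [lt|ge] := ltnP k N.+1; last first.
  by rewrite big1 // => i _; have := ltn_ord i; case: eqP => //; lia.
rewrite (bigD1 (Ordinal lt)) //= eqxx big1 ?addr0 // => i; rewrite -val_eqE /=.
by move=> /negPf ->.
Qed.

Lemma path_lamA t : \sum_s path_lam s * path_A s t = 0.
Proof.
rewrite big_sumType /= big_sumType /=.
case: t => [[z|j]|z] /=.
- rewrite [X in _ + X]big1 ?addr0; last by move=> i _; rewrite mulr0.
  rewrite (bigD1 z) //= eqxx [X in _ + X + _]big1 ?addr0; last first.
    by move=> z' /negPf ->; rewrite !mulr0.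
  under eq_bigr do rewrite mulrA.
  by rewrite -mulr_sumr (sum_ord_eq 0) /=; ring.
- rewrite -!mulr_suml !sum_path_end //.
  have -> : \sum_(i < N.+1)
        2 * (2 * (i == j :> nat)%:R - (i.+1 == j :> nat)%:R - (j.+1 == i :> nat)%:R)
      = 2 * (2 - (0 < j)%N%:R - (j < N)%N%:R) :> int.
    rewrite -mulr_sumr !sumrB -mulr_sumr sum_ord_eq ltn_ord; congr (_ * (_ - _ - _)).
      case: (j : nat) (ltn_ord j) => [|k] lt; first by rewrite big1.
      by under eq_bigr do rewrite eqSS; rewrite sum_ord_eq (ltnW lt).
    by under eq_bigr do rewrite eq_sym; rewrite sum_ord_eq ltnS.
  have := ltn_ord j; move: (j : nat) => k; rewrite ltnS leq_eqVlt lt0n.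
  by case: (k == 0)%N; case: (ltngtP k N).
- rewrite big1 ?add0r; last by move=> i _; rewrite mulr0.
  rewrite addrC (bigD1 z) //= eqxx [X in _ + X + _]big1 ?addr0; last first.
    by move=> z' /negPf ->; rewrite !mulr0.
  under eq_bigr do rewrite mulrA.
  by rewrite -mulr_sumr sum_ord_eq ltnSn; ring.
Qed.

Lemma path_linked_lend z (i : 'I_N.+1) :
  @linked M (lend z) (node i) = (i == 0%N :> nat).
Proof.
rewrite /linked /= /path_m /=; case: eqP => // _.
by case: (path_end_cases endL) => ->.
Qed.

Lemma path_linked_rend z (i : 'I_N.+1) :
  @linked M (rend z) (node i) = (i == N :> nat).
Proof.
rewrite /linked /= /path_m /= eqSS; case: eqP => // _.
by case: (path_end_cases endR) => ->.
Qed.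

Lemma path_linked_node (i j : 'I_N.+1) :
  @linked M (node i) (node j) = (i.+1 == j :> nat) || (j.+1 == i :> nat).
Proof.
rewrite /linked /= /path_m; case: eqP => [[->]|_]; last by case: ifP.
by rewrite orbb; lia.
Qed.

Lemma path_linked_ends x y : @linked M x y ->
  (exists i, x = node i) \/ (exists i, y = node i).
Proof.
case: x y => [[z|i]|z] [[z'|j]|z'] //=; try by [left; eexists|right; eexists].
all: by rewrite /linked /= /path_m; case: eqP.
Qed.

Lemma path_conn s t : connect (fun a b => 2 < @cox_m M a b)%N s t.
Proof.
apply: (@connect_from _ _ (node ord0)) => {s t} [a b|]; first by rewrite cox_m_sym.
have node_conn (k : nat) (lt : (k < N.+1)%N) :
    connect (fun a b => 2 < @cox_m M a b)%N (node ord0) (node (Ordinal lt)).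
  elim: k lt => [|k IH] lt; first by rewrite (_ : Ordinal lt = ord0) //; exact: val_inj.
  apply: connect_trans (IH (ltnW lt)) (connect1 _).
  by rewrite -/(@linked M _ _) path_linked_node /= eqxx.
case=> [[z|[k lt]]|z]; last 1 first.
- apply: connect_trans (node_conn N (ltnSn N)) (connect1 _).
  by rewrite -/(@linked M _ _) linkedC path_linked_rend.
- by apply: connect1; rewrite -/(@linked M _ _) linkedC path_linked_lend.
- exact: node_conn.
Qed.

Lemma path_end_card (T : finType) m : path_end T m -> (0 < #|T|)%N.
Proof.
by move=> e; apply/card_gt0P; case: e => -[_ [z _]]; exists z.
Qed.

Definition path_datum : affine_datum M.
Proof.
refine (@AffineDatum M path_A path_lam path_d path_cartan path_lam_gt0 path_lamA
  path_d_gt0 path_dA path_conn _).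
rewrite !card_sum card_ord.
by have := path_end_card endL; have := path_end_card endR; lia.
Defined.

End PathDatum.

(** * Pendant pairs in the path types *)

Section PathPendant.
Variables (N : nat) (L R : finType) (mL mR : nat).
Hypotheses (mL_gt1 : 1 < mL) (mR_gt1 : 1 < mR).
Hypotheses (endL : path_end L mL) (endR : path_end R mR).
Local Notation M := (@path_matrix N.+2 L R mL mR mL_gt1 mR_gt1).
Local Notation S := (L + 'I_N.+1 + R)%type.
Local Notation node i := (inl (inr i) : S).
Local Notation lend z := (inl (inl z) : S).
Local Notation rend z := (inr z : S).

Let linked_lend := @path_linked_lend N L R mL mR mL_gt1 mR_gt1 endL.
Let linked_rend := @path_linked_rend N L R mL mR mL_gt1 mR_gt1 endR.
Let linked_node := @path_linked_node N L R mL mR mL_gt1 mR_gt1.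
Let cA := @path_cartan N L R mL mR mL_gt1 mR_gt1 endL endR.

Lemma path_nbr (i : 'I_N.+1) r : @linked M (node i) r ->
  [\/ exists z, r = lend z /\ i = 0 :> nat, exists z, r = rend z /\ i = N :> nat
    | exists j : 'I_N.+1, r = node j /\ (i.+1 = j :> nat \/ j.+1 = i :> nat)].
Proof.
case: r => [[z|j]|z].
- by rewrite linkedC linked_lend => /eqP i0; constructor 1; exists z.
- rewrite linked_node => /orP ij; constructor 3; exists j; split=> //.
  by case: ij => /eqP; auto.
- by rewrite linkedC linked_rend => /eqP iN; constructor 2; exists z.
Qed.

Lemma lend_nbr z r : @linked M (lend z) r -> r = node ord0.
Proof.
move=> /[dup] /path_linked_ends [[i] //|[i ->]]; rewrite linked_lend => /eqP i0.
by congr (node _); apply: val_inj.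
Qed.

Lemma rend_nbr z r : @linked M (rend z) r -> r = node ord_max.
Proof.
move=> /[dup] /path_linked_ends [[i] //|[i ->]]; rewrite linked_rend => /eqP iN.
by congr (node _); apply: val_inj.
Qed.

(** A node of the path has a neighbour on each side. *)
Lemma node_not_pendant u (i : 'I_N.+1) t : ~ @pendant M u (node i) t.
Proof.
case=> _ _ only _ _.
have [l [il lE]] : exists l, @linked M (node i) l /\
    ((exists z, l = lend z) \/ exists2 j : 'I_N.+1, l = node j & j < i).
  have [i0|i0] := posnP i.
    have /card_gt0P [z _] := path_end_card endL.
    by exists (lend z); rewrite linkedC linked_lend i0; split=> //; left; exists z.
  have lt : i.-1 < N.+1 by have := ltn_ord i; lia.
  exists (node (Ordinal lt)); rewrite linked_node /= prednK // eqxx orbT.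
  by split=> //; right; exists (Ordinal lt) => //=; lia.
have [r [ir rE]] : exists r, @linked M (node i) r /\
    ((exists z, r = rend z) \/ exists2 j : 'I_N.+1, r = node j & i < j).
  have [iN|iN] := eqVneq (i : nat) N.
    have /card_gt0P [z _] := path_end_card endR.
    by exists (rend z); rewrite linkedC linked_rend iN; split=> //; left; exists z.
  have lt : i.+1 < N.+1 by have := ltn_ord i; lia.
  exists (node (Ordinal lt)); rewrite linked_node /= eqxx; split=> //.
  by right; exists (Ordinal lt).
have lr : l = r by rewrite (only _ il) (only _ ir).
case: lE rE => [[z lz]|[j lj ji]] [[z' rz]|[j' rj ij]]; move: lr;
  rewrite ?lz ?lj ?rz ?rj //.
by case=> jj; move: ji ij; rewrite jj; lia.
Qed.

Variable u : seq S.
Hypothesis clean_rot : forall j, @clean M (rot j u).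
Hypothesis full : forall s, s \in u.

Lemma inord_nodeE (i : nat) (j : 'I_N.+1) : i = j -> node j = node (inord i).
Proof. by move=> ->; rewrite inord_val. Qed.

Lemma count_nodes_left : count_mem (node ord0) u = 1 ->
  forall i : 'I_N.+1, count_mem (node i) u = 1.
Proof.
move=> n0 i; rewrite (inord_nodeE (erefl (i : nat))).
apply: (@path_count1 M _ cA u clean_rot full N (fun i => node (inord i))
  (fun r => if r is inr _ then true else false)) => //; last by rewrite -ltnS ltn_ord.
- move=> {}i lt; rewrite /= /path_m; case: eqP => [[/(congr1 val)] /=|_].
    by rewrite !inordK; lia.
  by rewrite !inordK ?eqxx //; lia.
- move=> {}i r /andP [i0 iN] /path_nbr; rewrite inordK; last lia.
  case=> [[z [_ ?]]|[z [_ ?]]|[j [-> ij]]]; [lia|lia|].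
  by case: ij => ij; [right|left]; apply: inord_nodeE; lia.
- move=> r N0 /path_nbr; rewrite inordK; last lia.
  case=> [[z [_ ?]]|[z [-> _]]|[j [-> ij]]]; [lia|by right|left].
  by apply: inord_nodeE; have := ltn_ord j; lia.
- move=> [//|z] _; split; first by rewrite linkedC linked_rend inordK.
  by move=> r /rend_nbr ->; apply: inord_nodeE.
- case: endR => -[mE].
    case=> z zE; left; exists (rend z).
      by rewrite /= /path_m /= inordK // eqxx.
    by case=> // z'; rewrite (zE z') eqxx.
  case=> z1 [z2 [z12 zE]]; right=> -[//|z] _; split.
    by rewrite /= /path_m /= inordK // eqxx.
  have [zz|zz] := zE z; [exists (rend z2)|exists (rend z1)]; rewrite zz; split=> //.
  + by rewrite eq_sym; exact: z12.
  + by case=> // z' _; case: (zE z') => ->; auto.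
  + by case=> // z' _; case: (zE z') => ->; auto.
- by rewrite -(inord_nodeE (j := ord0)).
Qed.

Lemma count_nodes_right : count_mem (node ord_max) u = 1 ->
  forall i : 'I_N.+1, count_mem (node i) u = 1.
Proof.
move=> n0 i; have lt_i := ltn_ord i.
rewrite (@inord_nodeE (N - (N - i))); last lia.
apply: (@path_count1 M _ cA u clean_rot full N (fun i => node (inord (N - i)))
  (fun r => if r is inl (inl _) then true else false)) => //; last lia.
- move=> {lt_i}i lt; rewrite /= /path_m; case: eqP => [[/(congr1 val)] /=|_].
    by rewrite !inordK; lia.
  rewrite !inordK; try lia.
  by rewrite (_ : (N - i.+1).+1 == N - i) ?orbT //; apply/eqP; lia.
- move=> {lt_i}i r /andP [i0 iN] /path_nbr; rewrite inordK; last lia.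
  case=> [[z [_ ?]]|[z [_ ?]]|[j [-> ij]]]; [lia|lia|].
  by case: ij => ij; [left|right]; apply: inord_nodeE; lia.
- move=> r N0 /path_nbr; rewrite inordK; last lia.
  case=> [[z [-> _]]|[z [_ ?]]|[j [-> ij]]]; [by right|lia|left].
  by apply: inord_nodeE; have := ltn_ord j; lia.
- move=> [[z|//]|//] _; split; first by rewrite linkedC linked_lend inordK ?subnn.
  by move=> r /lend_nbr ->; apply: inord_nodeE; rewrite subnn.
- case: endL => -[mE].
    case=> z zE; left; exists (lend z).
      by rewrite /= /path_m /= inordK ?subnn.
    by case=> [[z'|//]|//]; rewrite (zE z') eqxx.
  case=> z1 [z2 [z12 zE]]; right=> -[[z|//]|//] _; split.
    by rewrite /= /path_m /= inordK ?subnn.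
  have [zz|zz] := zE z; [exists (lend z2)|exists (lend z1)]; rewrite zz; split=> //.
  + by rewrite eq_sym; exact: z12.
  + by case=> [[z'|//]|//] _; case: (zE z') => ->; auto.
  + by case=> [[z'|//]|//] _; case: (zE z') => ->; auto.
- by rewrite -(inord_nodeE (j := ord_max)) //= subn0.
Qed.

(** A pendant pair forces [u] to be a Coxeter element: its neighbour occurs
    once, hence every node of the path does, hence every leaf. *)
Lemma path_pendant_uniq : (exists s t, @pendant M u s t) -> uniq u.
Proof.
move=> [s [t pst]].
have nodes : forall i : 'I_N.+1, count_mem (node i) u = 1.
  case: pst (pst) => st _ _ _ t1 pst; move: s pst st => [[z|i]|z] pst.
  - by move=> /lend_nbr tE; apply: count_nodes_left; rewrite -tE.
  - by case: (node_not_pendant pst).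
  - by move=> /rend_nbr tE; apply: count_nodes_right; rewrite -tE.
apply: count_mem_uniq => r; rewrite full; case: r => [[z|i]|z].
- by apply: (count_leaf cA clean_rot full (a := node ord0)) => // r /lend_nbr.
- exact: nodes.
- by apply: (count_leaf cA clean_rot full (a := node ord_max)) => // r /rend_nbr.
Qed.
End PathPendant.

(** * The theorem *)

Lemma bounded_words_finite (M : coxeterMatrix) (P : coxeterGroup M -> Prop) N :
  (forall w, P w -> exists2 u, word_elt u = w & size u <= N) ->
  finite_set [set w | P w]%classic.
Proof.
move=> H.
(* Pad words with [None] to the common length [N]. *)
pose f (t : N.-tuple (option (cox_gen M))) := word_elt (pmap id t).
apply: (@sub_finite_set _ _ (f @` [set: N.-tuple (option (cox_gen M))])%classic);
  last exact/finite_image/finite_finset.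
move=> w /= /H [u <- le_u].
have sz : size (map Some u ++ nseq (N - size u) None) == N.
  by rewrite size_cat size_map size_nseq subnKC.
exists (Tuple sz) => //; rewrite /f /= pmap_cat; congr word_elt.
rewrite map_pK // (_ : pmap id (nseq _ None) = [::]) ?cats0 //.
by elim: (_ - _).
Qed.

Section AffineTheorem.
Variables (M : coxeterMatrix) (D : affine_datum M).
Local Notation S := (cox_gen M).
Let A := aff_A D.
Let cA : cartan A := aff_cartan D.
Implicit Types (u v : seq S) (s t : S) (w : coxeterGroup M).

Hypothesis pendant_uniq : forall u, (forall j, clean (rot j u)) ->
  (forall s, s \in u) -> (exists s t, pendant u s t) -> uniq u.

Lemma affine_nbr s : exists t : S, linked s t.
Proof.
have /card_gt0P [r] : 0 < #|predC1 s|.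
  by rewrite cardC1; have := aff_card D; lia.
rewrite !inE; have /connectP [[|t p] /= pth ->] := aff_conn D s r.
  by rewrite eqxx.
by case/andP: pth => st _ _; exists t.
Qed.

Lemma affine_no_isolated_edge s t : linked s t ->
  exists r : S, (linked s r && (r != t)) || (linked t r && (r != s)).
Proof.
move=> st; apply: contrapT => none.
have stay a b : a \in [:: s; t] -> linked a b -> b \in [:: s; t].
  move=> a_st ab; apply/negPn/negP; rewrite !inE negb_or => /andP [bs bt].
  apply: none; exists b; rewrite bs bt !andbT.
  by move: a_st ab; rewrite !inE => /orP [] /eqP -> ->; rewrite ?orbT.
have : 0 < #|predC (mem [:: s; t])|.
  rewrite -(ltn_add2l #|mem [:: s; t]|) addn0 cardC.
  exact: leq_ltn_trans (card_size [:: s; t]) (aff_card D).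
case/card_gt0P => r; rewrite inE /= => /negP; apply.
have /connectP [p pth ->] := aff_conn D s r.
have walk a : path (fun b c => 2 < cox_m b c) a p -> a \in [:: s; t] ->
    last a p \in [:: s; t].
  elim: p a {pth} => //= b p IH a /andP [ab /IH pth] a_st.
  exact/pth/(stay _ _ a_st ab).
by apply: walk pth _; rewrite inE eqxx.
Qed.

Lemma word_elt_power k u : word_elt (power k u) = (word_elt u ^+ k)%g.
Proof.
elim: k => [|k IH]; first by rewrite /word_elt big_nil expg0.
by rewrite -[power _ _]/(u ++ power k u) word_elt_cat IH expgS.
Qed.

Lemma cfc_clean w u : cyclically_fully_commutative w -> reduced_expr w u ->
  forall j, clean (rot j u).
Proof.
move=> cfc uw j; have [/reduced_exprE [_ rj] fc] := cfc u j uw.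
apply: (clean_of_unique cA rj) => v rv uv; apply: fc; apply/reduced_exprE.
  by split.
by split=> //; apply/word_eltP/cox_eq_sym.
Qed.

Lemma cfc_support w u v : cyclically_fully_commutative w ->
  reduced_expr w u -> reduced_expr w v -> full_support u -> full_support v.
Proof.
move=> cfc uw vw fu s; have [_] := cfc u 0 uw; rewrite rot0 => fc.
have uE : word_elt u = w by case: uw.
rewrite uE in fc; have /(cc_perm cA)/perm_mem <- := fc u v uw vw; exact: fu.
Qed.

Lemma full_support_power_reduced w u k : cyclically_fully_commutative w ->
  reduced_expr w u -> full_support u -> reduced (power k u).
Proof.
move=> cfc uw fu; have crot := cfc_clean cfc uw.
have [c|/(pendant_uniq crot fu) uu] :=
    clean_power cA crot fu affine_nbr affine_no_isolated_edge.
  by have [] := clean_matsumoto cA (c k).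
exact: (coxeter_power_reduced cA (aff_lam_gt0 D) (aff_lamA D)).
Qed.

Lemma logarithmic_of_full_support w u : cyclically_fully_commutative w ->
  reduced_expr w u -> full_support u -> logarithmic w.
Proof.
move=> cfc uw fu k _; have rk := @full_support_power_reduced w u k cfc uw fu.
case: uw => <- <-; rewrite -word_elt_power reduced_length // size_power //.
Qed.

Lemma missing_letter_bounded : exists N, forall u, reduced u ->
  ~ full_support u -> size u <= N.
Proof.
have /choice [n nP] o := parabolic_bounded cA (aff_lam_gt0 D) (aff_lamA D)
  (aff_d_gt0 D) (aff_dA D) (aff_conn D) o.
exists (\max_o n o) => u ru /existsNP [o /negP ou].
by apply: leq_trans (nP o u ru ou) _; exact: leq_bigmax.
Qed.

Lemma full_support_of_logarithmic w u : w <> 1%g -> logarithmic w ->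
  reduced_expr w u -> full_support u.
Proof.
move=> w1 logw [uw sz]; apply: contrapT => nfu.
have [N bound] := missing_letter_bounded.
have u0 : 0 < size u.
  by case: u {nfu sz} uw => // uw; case: w1; rewrite -uw /word_elt big_nil.
have rk : reduced (power N.+1 u).
  apply: (iffLR (reduced_exprE (w ^+ N.+1)%g _) _).2; split.
    by rewrite word_elt_power uw.
  by rewrite size_power logw // sz.
have nfk : ~ full_support (power N.+1 u).
  by move=> full; apply: nfu => s; have /flattenP [x /nseqP [-> _]] := full s.
by have := bound _ rk nfk; rewrite size_power; nia.
Qed.

Lemma affine_cfc_logarithmic :
  (forall w : coxeterGroup M, cyclically_fully_commutative w ->
     ((exists2 u, reduced_expr w u & full_support u) <->
      (forall u, reduced_expr w u -> full_support u)) /\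
     (w <> 1%g ->
        (logarithmic w <-> exists2 u, reduced_expr w u & full_support u))) /\
  finite_set
    [set w : coxeterGroup M |
       cyclically_fully_commutative w /\ ~ logarithmic w]%classic.
Proof.
split=> [w cfc|].
  have [u uw] := reduced_expr_ex w; split.
    split=> [[v vw fv] x xw|H]; first exact: cfc_support cfc vw xw fv.
    by exists u => //; exact: H.
  move=> w1; split=> [logw|[v vw fv]]; last exact: logarithmic_of_full_support vw fv.
  by exists u => //; exact: full_support_of_logarithmic uw.
have [N bound] := missing_letter_bounded.
apply: (@bounded_words_finite _ _ N) => w [cfc nlog].
have [u uw] := reduced_expr_ex w; have [uE ru] := (reduced_exprE w u).1 uw.
exists u => //; apply: bound => // fu; apply: nlog.
exact: logarithmic_of_full_support uw fu.
Qed.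
End AffineTheorem.

Theorem theorem3p10 (M : coxeterMatrix) (affM : classical_affine M) :
  (forall w : coxeterGroup M, cyclically_fully_commutative w ->
     ((exists2 u, reduced_expr w u & full_support u) <->
      (forall u, reduced_expr w u -> full_support u)) /\
     (w <> 1%g ->
        (logarithmic w <-> exists2 u, reduced_expr w u & full_support u))) /\
  finite_set
    [set w : coxeterGroup M |
       cyclically_fully_commutative w /\ ~ logarithmic w]%classic.
Proof.
case: affM => n n_ge.
- apply: (affine_cfc_logarithmic (cycle_datum n_ge)) => u _ _ [s [t pst]].
  by case: (cycle_no_pendant n_ge pst).
- case: n n_ge => [|[|n]] // _.
  apply: (affine_cfc_logarithmic (@path_datum n bool unit 3 4 isT isT
    path_end_bool path_end_unit)) => u crot full.
  exact: (path_pendant_uniq path_end_bool path_end_unit crot full).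
- case: n n_ge => [|[|n]] // _.
  apply: (affine_cfc_logarithmic (@path_datum n unit unit 4 4 isT isT
    path_end_unit path_end_unit)) => u crot full.
  exact: (path_pendant_uniq path_end_unit path_end_unit crot full).
- case: n n_ge => [|[|n]] // _.
  apply: (affine_cfc_logarithmic (@path_datum n bool bool 3 3 isT isT
    path_end_bool path_end_bool)) => u crot full.
  exact: (path_pendant_uniq path_end_bool path_end_bool crot full).
Qed.
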